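(* Let $\Bbbk$ be a field, $S=\Bbbk[x_1,\dots,x_n]$, let $I\subset S$ be a monomial ideal, and fix a monomial (multidegree) $m$ of $S$. Then, for all integers $i$, the following numbers are equal: (i) $b_{i,m}(I)$; (ii) $b_{i,m}\bigl(I\cap(\tfrac{m}{\sqrt m})\bigr)$; (iii) $b_{i,\sqrt m}\bigl(I:\tfrac{m}{\sqrt m}\bigr)$; (iv) $b_{i,\sqrt m}(\operatorname{Shadow}_m(I))$. Here (i), (ii), (iii) are multigraded Betti numbers of ideals of $S$ over $S$, while (iv) is a multigraded Betti number, over the ring $\Bbbk[\operatorname{supp}(m)]$, of an ideal of $\Bbbk[\operatorname{supp}(m)]$.
   Context: $S$ carries the $\mathbb{Z}^n$-multigrading, with multidegrees written multiplicatively, so that multidegrees are indexed by monomials ($\operatorname{mdeg}x_i=x_i$) and $S_m$ is the one-dimensional span of $m$. For a multigraded module $M$ over a polynomial ring $R$, $b_{i,m}(M)=\dim_{\Bbbk}\operatorname{Tor}^R_i(\Bbbk,M)_m$. For a monomial $m=\prod x_\ell^{p_\ell}$, $\operatorname{supp}(m)=\{x_\ell:p_\ell\ne0\}$ and $\sqrt m=\prod_{p_\ell\ne0}x_\ell$. For a monomial ideal $J$, $\operatorname{sqfree}(J)$ is the ideal generated by the squarefree monomials in $J$. The shadow of $m$ in $I$ is the squarefree monomial ideal of $\Bbbk[\operatorname{supp}(m)]$ given by $\operatorname{Shadow}_m(I)=\operatorname{sqfree}\bigl((I:\tfrac{m}{\sqrt m})\cap\Bbbk[\operatorname{supp}(m)]\bigr)$.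 *)

(* Defs.v *)
From Stdlib Require Import ClassicalEpsilon.
From HB Require Import structures.
From mathcomp Require Import all_boot all_order all_algebra.
From mathcomp Require Import mpoly.

Set Implicit Arguments.
Unset Strict Implicit.
Unset Printing Implicit Defensive.

Import GRing.Theory.
Local Open Scope ring_scope.

Section Ideals.
Variables (k : fieldType) (n : nat).
Local Notation S := {mpoly k[n]}.
Implicit Types (I J A : S -> Prop) (f p : S).

Definition ideal_gen A : S -> Prop := fun p =>
  exists (r : nat) (a g : 'I_r -> S),
    (forall j, A (g j)) /\ p = \sum_(j < r) a j * g j.

Definition monomial_gen (A : 'X_{1..n} -> Prop) : S -> Prop :=
  ideal_gen (fun g => exists2 a, A a & g = 'X_[a]).

(* The zero ideal (A empty) and the unit ideal (A containing the exponent 0) are allowed. *)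
Definition monomial_ideal I : Prop :=
  exists A : 'X_{1..n} -> Prop, forall p, I p <-> monomial_gen A p.

Definition principal f : S -> Prop := ideal_gen (fun g => g = f).

Definition cap I J : S -> Prop := fun p => I p /\ J p.

Definition colon I f : S -> Prop := fun p => I (p * f).

Definition squarefree (a : 'X_{1..n}) : Prop := forall l, (a l <= 1)%N.

Definition sqfree I : S -> Prop :=
  monomial_gen (fun a => squarefree a /\ I 'X_[a]).

Definition mnm_sqrt (m : 'X_{1..n}) : 'X_{1..n} :=
  [multinom (m l != 0 : nat) | l < n].

(* The monomial m / sqrt m: the truncated difference of exponents is exact,
   since sqrt m divides m. *)
Definition mnm_cosqrt (m : 'X_{1..n}) : 'X_{1..n} := (m - mnm_sqrt m)%MM.

Definition supp (m : 'X_{1..n}) : {set 'I_n} := [set l | m l != 0].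

End Ideals.

(* For V a set of variables of S = k[x_0, .., x_(n-1)], the polynomial ring k[V]
   is {mpoly k[#|V|]}: its j-th variable stands for x_(enum_val j). *)
Section Subring.
Variables (k : fieldType) (n : nat) (V : {set 'I_n}).

Definition sub_embed (p : {mpoly k[#|V|]}) : {mpoly k[n]} :=
  p \mPo [tuple 'X_(enum_val j) | j < #|V|].

Definition sub_contract (I : {mpoly k[n]} -> Prop) : {mpoly k[#|V|]} -> Prop :=
  fun p => I (sub_embed p).

Definition sub_mnm (a : 'X_{1..n}) : 'X_{1..#|V|} :=
  [multinom a (enum_val j) | j < #|V|].

End Subring.

Definition Shadow (k : fieldType) (n : nat) (m : 'X_{1..n})
    (I : {mpoly k[n]} -> Prop) : {mpoly k[#|supp m|]} -> Prop :=
  sqfree (sub_contract (V := supp m) (colon I 'X_[mnm_cosqrt m])).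
Arguments Shadow {k n} m I _.

Section Tor.
Variables (k : fieldType) (n : nat).
Local Notation R := {mpoly k[n]}.

(* v, an element of the free module with basis elements of multidegrees deg j,
   is homogeneous of multidegree m. *)
Definition homogeneous r (deg : 'I_r -> 'X_{1..n}) (m : 'X_{1..n})
    (v : 'rV[R]_r) : Prop :=
  forall j u, u \in msupp (v 0 j) -> (u + deg j)%MM = m.

(* A multigraded free resolution
     .. -> F_2 -> F_1 -> F_0 -> k -> 0
   of k = R / (x_0, .., x_(n-1)), concentrated in multidegree 0.
   F_i = R^(fr_rank i) consists of row vectors, with the j-th basis element in
   multidegree fr_deg i j; the map F_(i+1) -> F_i is v |-> v *m fr_diff i.
   R acts on k by evaluation at the origin, so that the R-linear map F_0 -> k
   sending the j-th basis element to fr_aug j is fr_augment. *)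
Record free_resolution := FreeResolution {
  fr_rank : nat -> nat;
  fr_deg : forall i, 'I_(fr_rank i) -> 'X_{1..n};
  fr_diff : forall i, 'M[R]_(fr_rank i.+1, fr_rank i);
  fr_aug : 'I_(fr_rank 0) -> k;
  fr_augment := fun v : 'rV[R]_(fr_rank 0) =>
    \sum_j (v 0 j).@[fun=> 0] * fr_aug j;
  fr_diff_homogeneous : forall i a,
    homogeneous (@fr_deg i) (fr_deg a) (row a (fr_diff i));
  fr_aug_homogeneous : forall j, fr_aug j != 0 -> fr_deg j = 0%MM;
  fr_aug_surj : forall c : k, exists v, fr_augment v = c;
  fr_exact0 : forall v, fr_augment v = 0 <-> exists w, v = w *m fr_diff 0;
  fr_exact : forall i (v : 'rV[R]_(fr_rank i.+1)),
    v *m fr_diff i = 0 <-> exists w, v = w *m fr_diff i.+1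
}.

(* For an ideal J of R, F_i being free, F_i (x) J is the module of row vectors
   with entries in J; tor_chain is its component of multidegree m. *)
Definition tor_chain (F : free_resolution) (J : R -> Prop) (i : nat)
    (m : 'X_{1..n}) (v : 'rV[R]_(fr_rank F i)) : Prop :=
  (forall j, J (v 0 j)) /\ homogeneous (@fr_deg F i) m v.

Definition tor_cycle (F : free_resolution) (J : R -> Prop) (i : nat)
    (m : 'X_{1..n}) : 'rV[R]_(fr_rank F i) -> Prop :=
  match i with
  | 0%N => fun v => tor_chain J m v
  | i'.+1 => fun v => tor_chain J m v /\ v *m fr_diff F i' = 0
  end.

Definition tor_boundary (F : free_resolution) (J : R -> Prop) (i : nat)
    (m : 'X_{1..n}) (v : 'rV[R]_(fr_rank F i)) : Prop :=
  exists2 w, tor_chain J m w & v = w *m fr_diff F i.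

(* dim_k Z / B = d: some d elements of Z form a k-basis of Z modulo B. *)
Definition quotient_dim (V : lmodType R) (Z B : V -> Prop) (d : nat) : Prop :=
  exists b : 'I_d -> V, (forall j, Z (b j)) /\
    forall z, Z z -> exists! c : {ffun 'I_d -> k},
      B (z - \sum_j (c j)%:MP *: b j).

(* dim_k Tor_i^R(k, J)_m, where Tor_i^R(k, J) is the i-th homology module of
   F (x) J for a multigraded free resolution F of k. *)
Definition betti_nat (J : R -> Prop) (i : nat) (m : 'X_{1..n}) : nat :=
  epsilon (inhabits 0%N) (fun d => exists F : free_resolution,
    quotient_dim (@tor_cycle F J i m) (@tor_boundary F J i m) d).

Definition betti (J : R -> Prop) (i : int) (m : 'X_{1..n}) : nat :=
  match i with
  | Posz i => betti_nat J i m
  | Negz _ => 0%N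
  end.

End Tor.

(* Main.v *)
(* The multidegree-u strand of a multigraded free module is the space of scalar
   rows supported on the basis elements of degree <= u, so a multigraded free
   resolution F of k is a family of scalar matrices whose strands are exact, and
   the multidegree-m component of F (x) J is spanned by the basis elements of
   degree u with u <= m and x^(m-u) in J.  The comparison theorem, carried out on
   scalar matrices, makes the homology independent of F, so it may be computed
   from the Koszul complex, whose degrees u are squarefree.  For squarefree u, the
   condition "u <= m and x^(m-u) in I" is the same for the ideals in (i), (ii) and
   (iii).  For (iv), only basis elements with degrees supported on supp(m) matter,
   and they form a resolution of k over k[supp(m)]. *)
From Stdlib Require Import ClassicalEpsilon FunctionalExtensionality PropExtensionality.
Require Import Defs.
From mathcomp Require Import all_boot all_order all_algebra.
From mathcomp Require Import mpoly.

Set Implicit Arguments.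
Unset Strict Implicit.
Unset Printing Implicit Defensive.

Import GRing.Theory.
Local Open Scope ring_scope.

(** [betti_nat] selects by [epsilon] some d for which some resolution has homology of dimension d.
    Equality of two Betti numbers is therefore obtained from equality of the two predicates in d, by
    functional and propositional extensionality, and no dimension is ever computed. This requires
    two things: the predicate must not depend on the resolution, and the resolution chosen for the
    computation must itself be an instance of [free_resolution]; hence the translations in both
    directions between polynomial and scalar data. Scalars suffice because a homogeneous matrix
    entry is a scalar times the one monomial fixed by the degrees of its row and column. The ideal
    and the multidegree enter only through the set of contributing degrees, which is closed under
    divisors. Homogeneous maps only lower degrees, so chain maps and homotopies built once act on
    the rows supported in any such set, and one comparison theorem serves all ideals and all
    multidegrees. *)

(** Chain maps and homotopies are built degree by degree with it: the matrix type varies with [i],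
    and the invariant [P] records what makes the next step solvable. *)
Lemma dependent_choice_nat (T : nat -> Type) (P : forall i, T i -> Prop)
    (R : forall i, T i -> T i.+1 -> Prop) :
  (exists x, P 0%N x) ->
  (forall i x, P i x -> exists2 y, R i x y & P i.+1 y) ->
  exists f : forall i, T i, (forall i, P i (f i)) /\ (forall i, R i (f i) (f i.+1)).
Proof.
move=> /constructive_indefinite_description[x0 Px0] step.
pose next i (x : {x : T i | P i x}) : {y : T i.+1 | R i (sval x) y /\ P i.+1 y} :=
  constructive_indefinite_description _
    (let: ex_intro2 y Rxy Py := step i _ (svalP x) in ex_intro _ y (conj Rxy Py)).
pose F := fix F i : {x : T i | P i x} :=
  match i with
  | 0%N => exist _ x0 Px0
  | i'.+1 => exist _ (sval (next i' (F i'))) (svalP (next i' (F i'))).2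
  end.
exists (fun i => sval (F i)); split=> i; first exact: svalP.
exact: (svalP (next i (F i))).1.
Qed.

(** * Dimensions of quotients of cycles by boundaries *)

Section QuotientDimension.
Variable k : fieldType.

(* [quotient_dim] for an arbitrary scaling operation, so as to compare a
   [{mpoly k[n]}]-module with a [k]-vector space. *)
Definition quotient_dim_for (V : zmodType) (sc : k -> V -> V) (Z B : V -> Prop)
    (d : nat) : Prop :=
  exists b : 'I_d -> V, (forall j, Z (b j)) /\
    forall z, Z z -> exists! c : {ffun 'I_d -> k}, B (z - \sum_j sc (c j) (b j)).

(** The maps [f] and [g] are inverse only modulo boundaries, as for a homotopy equivalence. The
    basis is pushed forward along [f]; coordinates of [z] are those of [g z], and their uniqueness
    follows after replacing each [g (f (b j))] by [b j] up to a boundary. *)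
Lemma quotient_dim_transfer (V W : zmodType) (scV : k -> V -> V) (scW : k -> W -> W)
    (ZV BV : V -> Prop) (ZW BW : W -> Prop) (f : V -> W) (g : W -> V) d :
  {morph f : x y / x - y} -> (forall c, {morph f : x / scV c x >-> scW c x}) ->
  {morph g : x y / x - y} -> (forall c, {morph g : x / scW c x >-> scV c x}) ->
  (forall c, {morph scV c : x y / x - y}) ->
  (forall c, {morph scW c : x y / x - y}) ->
  BV 0 -> (forall x y, BV x -> BV y -> BV (x - y)) ->
  (forall c x, BV x -> BV (scV c x)) ->
  BW 0 -> (forall x y, BW x -> BW y -> BW (x - y)) ->
  (forall c x, BW x -> BW (scW c x)) ->
  (forall z, ZV z -> ZW (f z)) -> (forall z, ZW z -> ZV (g z)) ->
  (forall z, BV z -> BW (f z)) -> (forall z, BW z -> BV (g z)) ->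
  (forall z, ZV z -> BV (z - g (f z))) -> (forall z, ZW z -> BW (z - f (g z))) ->
  quotient_dim_for scV ZV BV d -> quotient_dim_for scW ZW BW d.
Proof.
move=> fB fZ gB gZ scVB scWB BV0 BVB BVZ BW0 BWB BWZ ZVW ZWV BVW BWV gfK fgK [b [Zb bP]].
have morph0 (U T : zmodType) (h : U -> T) : {morph h : x y / x - y} -> h 0 = 0.
  by move=> hB; rewrite -(subrr 0) hB subrr.
have morphD (U T : zmodType) (h : U -> T) :
    {morph h : x y / x - y} -> {morph h : x y / x + y}.
  by move=> hB x y; rewrite -[y in LHS]opprK -(sub0r y) 2!hB (morph0 _ _ _ hB) sub0r opprK.
have sumB (U : zmodType) (B : U -> Prop) (F : 'I_d -> U) :
  B 0 -> (forall x y, B x -> B y -> B (x - y)) -> (forall j, B (F j)) -> B (\sum_j F j).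
  move=> B0 BB BF; elim/big_ind: _ => // x y Bx By.
  by rewrite -[y]opprK; apply: (BB) => //; rewrite -sub0r; apply: BB.
have fS (c : {ffun 'I_d -> k}) : f (\sum_j scV (c j) (b j)) = \sum_j scW (c j) (f (b j)).
  rewrite (big_morph _ (morphD _ _ _ fB) (morph0 _ _ _ fB)).
  by apply: eq_bigr => j _; rewrite fZ.
have gS (c : {ffun 'I_d -> k}) :
  g (\sum_j scW (c j) (f (b j))) = \sum_j scV (c j) (g (f (b j))).
  rewrite (big_morph _ (morphD _ _ _ gB) (morph0 _ _ _ gB)).
  by apply: eq_bigr => j _; rewrite gZ.
exists (f \o b); split=> [j|z Zz]; first exact: ZVW.
have [c [cP cU]] := bP _ (ZWV _ Zz).
have BWD x y : BW x -> BW y -> BW (x + y).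
  by move=> Bx By; rewrite -[y]opprK; apply: (BWB) => //; rewrite -sub0r; apply: BWB.
exists c; split=> [|c' c'P].
  have := BWD _ _ (fgK _ Zz) (BVW _ cP).
  by rewrite fB fS addrA subrK.
apply: cU; have := BWV _ c'P; rewrite gB gS => Bc'.
have: BV (\sum_j scV (c' j) (b j - g (f (b j)))).
  by apply: sumB => // j; apply/BVZ/gfK.
under eq_bigr do rewrite scVB.
rewrite big_split sumrN /= => Bd.
have := BVB _ _ Bc' Bd.
by rewrite opprB addrA subrK.
Qed.

End QuotientDimension.

(** * Strand resolutions and the comparison theorem *)

Section Strands.
Variables (k : fieldType) (n : nat).
Local Notation mnm := 'X_{1..n}.

Definition supported r (s : mnm -> Prop) (dg : 'I_r -> mnm) (v : 'rV[k]_r) : Prop :=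
  forall j, v 0 j != 0 -> s (dg j).

Definition below (u : mnm) : mnm -> Prop := fun w => (w <= u)%MM.

Definition downset (s : mnm -> Prop) : Prop :=
  forall u w, (w <= u)%MM -> s u -> s w.

(** The scalar [M a b] stands for the polynomial entry [M a b] times x^(dp a - dq b), so a nonzero
    entry needs divisibility of the degrees. *)
Definition graded p q (dp : 'I_p -> mnm) (dq : 'I_q -> mnm) (M : 'M[k]_(p, q)) : Prop :=
  forall a b, M a b != 0 -> (dq b <= dp a)%MM.

Lemma below_downset u : downset (below u).
Proof. by move=> v w le_wv le_vu; apply: lepm_trans le_wv le_vu. Qed.

Lemma supported0 r s (dg : 'I_r -> mnm) : supported s dg 0.
Proof. by move=> j; rewrite mxE eqxx. Qed.

Lemma supportedB r s (dg : 'I_r -> mnm) v w :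
  supported s dg v -> supported s dg w -> supported s dg (v - w).
Proof.
move=> sv sw j; rewrite !mxE; have [v0|/sv//] := eqVneq (v 0 j) 0.
by rewrite v0 sub0r oppr_eq0 => /sw.
Qed.

Lemma supportedZ r s (dg : 'I_r -> mnm) c v :
  supported s dg v -> supported s dg (c *: v).
Proof. by move=> sv j; rewrite mxE mulf_eq0 negb_or => /andP[_ /sv]. Qed.

Lemma sum_neq0 (T : finType) (F : T -> k) : \sum_t F t != 0 -> exists t, F t != 0.
Proof.
move=> nz; apply/existsP; apply: contraNT nz => /existsPn F0.
by rewrite big1 // => t _; apply/eqP; rewrite -[_ == _]negbK F0.
Qed.

(** A graded matrix only lowers degrees. Being a downset is all that the comparison theorem asks of
    [s]. *)
Lemma supported_mul p q s (dp : 'I_p -> mnm) (dq : 'I_q -> mnm) v M :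
  downset s -> graded dp dq M -> supported s dp v -> supported s dq (v *m M).
Proof.
move=> ds gM sv j; rewrite mxE => /sum_neq0[a].
by rewrite mulf_eq0 negb_or => /andP[/sv sa /gM le]; apply: ds sa.
Qed.

Lemma gradedM p q r (dp : 'I_p -> mnm) (dq : 'I_q -> mnm) (dr : 'I_r -> mnm) M N :
  graded dp dq M -> graded dq dr N -> graded dp dr (M *m N).
Proof.
move=> gM gN a c; rewrite mxE => /sum_neq0[b].
by rewrite mulf_eq0 negb_or => /andP[/gM le1 /gN le2]; apply: lepm_trans le1.
Qed.

Lemma gradedB p q (dp : 'I_p -> mnm) (dq : 'I_q -> mnm) M N :
  graded dp dq M -> graded dp dq N -> graded dp dq (M - N).
Proof.
move=> gM gN a b; rewrite !mxE; have [M0|/gM//] := eqVneq (M a b) 0.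
by rewrite M0 sub0r oppr_eq0 => /gN.
Qed.

Lemma graded1 p (dp : 'I_p -> mnm) : graded dp dp 1%:M.
Proof.
move=> a b; rewrite mxE; case: (a =P b) => [-> _|_]; last by rewrite eqxx.
exact: lepm_refl.
Qed.

Lemma graded_row p q (dp : 'I_p -> mnm) (dq : 'I_q -> mnm) M :
  graded dp dq M <-> forall a, supported (below (dp a)) dq (row a M).
Proof.
split=> [gM a j|gM a b]; first by rewrite mxE => /gM.
by have := gM a b; rewrite mxE.
Qed.

(* The degreewise (strandwise) description of a multigraded free resolution of
   k: the degree-u strand of the free module with basis degrees [sr_deg i] is
   the space of scalar rows supported on the basis elements of degree <= u, and
   the strands of k itself vanish except for u = 0. *)
Record strand_resolution := StrandResolution {
  sr_rank : nat -> nat;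
  sr_deg : forall i, 'I_(sr_rank i) -> mnm;
  sr_diff : forall i, 'M[k]_(sr_rank i.+1, sr_rank i);
  sr_aug : 'cV[k]_(sr_rank 0);
  sr_diff_graded : forall i, graded (@sr_deg i.+1) (@sr_deg i) (sr_diff i);
  sr_aug_deg : forall j, sr_aug j 0 != 0 -> sr_deg j = 0%MM;
  sr_aug_surj : exists2 v, supported (below 0%MM) (@sr_deg 0) v & v *m sr_aug = 1%:M;
  sr_exact0 : forall u v, supported (below u) (@sr_deg 0) v ->
    (u = 0%MM -> v *m sr_aug = 0) <->
    (exists2 w, supported (below u) (@sr_deg 1) w & v = w *m sr_diff 0);
  sr_exact : forall i u v, supported (below u) (@sr_deg i.+1) v ->
    v *m sr_diff i = 0 <->
    (exists2 w, supported (below u) (@sr_deg i.+2) w & v = w *m sr_diff i.+1)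
}.

Definition strand_cycle (F : strand_resolution) (s : mnm -> Prop) (i : nat) :
    'rV[k]_(sr_rank F i) -> Prop :=
  match i with
  | 0%N => fun v => supported s (@sr_deg F 0) v
  | i'.+1 => fun v => supported s (@sr_deg F i'.+1) v /\ v *m sr_diff F i' = 0
  end.

Definition strand_boundary (F : strand_resolution) (s : mnm -> Prop) (i : nat)
    (v : 'rV[k]_(sr_rank F i)) : Prop :=
  exists2 w, supported s (@sr_deg F i.+1) w & v = w *m sr_diff F i.

Definition strand_dim (F : strand_resolution) (s : mnm -> Prop) (i d : nat) : Prop :=
  quotient_dim_for (fun c (v : 'rV[k]_(sr_rank F i)) => c *: v)
    (@strand_cycle F s i) (@strand_boundary F s i) d.

Lemma strand_boundary0 F s i : @strand_boundary F s i 0.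
Proof. by exists 0; [apply: supported0 | rewrite mul0mx]. Qed.

Lemma strand_boundaryB F s i x y :
  @strand_boundary F s i x -> @strand_boundary F s i y -> strand_boundary s (x - y).
Proof.
move=> [v sv ->] [w sw ->]; exists (v - w); first exact: supportedB.
by rewrite mulmxBl.
Qed.

Lemma strand_boundaryZ F s i c x :
  @strand_boundary F s i x -> strand_boundary s (c *: x).
Proof.
move=> [v sv ->]; exists (c *: v); first exact: supportedZ.
by rewrite scalemxAl.
Qed.

Lemma strand_cycle_supported F s i v :
  @strand_cycle F s i v -> supported s (@sr_deg F i) v.
Proof. by case: i v => [|i] v // []. Qed.

Lemma strand_dim_transfer (F : strand_resolution) s i d
    (rG : nat) (Z B : 'rV[k]_rG -> Prop) M N :
  B 0 -> (forall x y, B x -> B y -> B (x - y)) -> (forall c x, B x -> B (c *: x)) ->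
  (forall v, @strand_cycle F s i v -> Z (v *m M)) ->
  (forall v, Z v -> strand_cycle s (v *m N)) ->
  (forall v, @strand_boundary F s i v -> B (v *m M)) ->
  (forall v, B v -> strand_boundary s (v *m N)) ->
  (forall v, @strand_cycle F s i v -> strand_boundary s (v - v *m M *m N)) ->
  (forall v, Z v -> B (v - v *m N *m M)) ->
  strand_dim F s i d -> quotient_dim_for (fun c (v : 'rV[k]_rG) => c *: v) Z B d.
Proof.
move=> B0 BB BZ ZM ZN BM BN MN NM.
apply: (@quotient_dim_transfer _ _ _ _ _ _ _ _ _ (mulmx^~ M) (mulmx^~ N)) => //.
- by move=> x y; rewrite mulmxBl.
- by move=> c x; rewrite scalemxAl.
- by move=> x y; rewrite mulmxBl.
- by move=> c x; rewrite scalemxAl.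
- by move=> c x y; rewrite scalerBr.
- by move=> c x y; rewrite scalerBr.
- exact: strand_boundary0.
- exact: strand_boundaryB.
- exact: strand_boundaryZ.
Qed.

(** * Lifting along exact strands *)

Section Lifting.
Variable G : strand_resolution.

(** This is the freeness of the source: rows are images of basis elements, so each is lifted on its
    own, inside the strand of its own degree. *)
Lemma lift_rows p (dp : 'I_p -> mnm) i (M : 'M[k]_(p, sr_rank G i)) :
  (forall a, exists2 w, supported (below (dp a)) (@sr_deg G i.+1) w
                      & row a M = w *m sr_diff G i) ->
  exists2 N, graded dp (@sr_deg G i.+1) N & M = N *m sr_diff G i.
Proof.
move=> liftM.
have /fin_all_exists[w wP] : forall a, exists w,
    supported (below (dp a)) (@sr_deg G i.+1) w /\ row a M = w *m sr_diff G i.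
  by move=> a; have [w sw Mw] := liftM a; exists w.
exists (\matrix_a w a); first by apply/graded_row=> a; rewrite rowK; case: (wP a).
by apply/row_matrixP=> a; rewrite row_mul rowK; case: (wP a).
Qed.

Lemma lift0 p (dp : 'I_p -> mnm) M :
  graded dp (@sr_deg G 0) M -> (forall a, dp a = 0%MM -> row a M *m sr_aug G = 0) ->
  exists2 N, graded dp (@sr_deg G 1) N & M = N *m sr_diff G 0.
Proof.
move=> /graded_row gM M0; apply: lift_rows => a.
by apply/sr_exact0 => //; apply: M0.
Qed.

Lemma liftS p (dp : 'I_p -> mnm) i M :
  graded dp (@sr_deg G i.+1) M -> M *m sr_diff G i = 0 ->
  exists2 N, graded dp (@sr_deg G i.+2) N & M = N *m sr_diff G i.+1.
Proof.
move=> /graded_row gM M0; apply: lift_rows => a.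
by apply/sr_exact => //; rewrite -row_mul M0 row0.
Qed.

(** Row [a] is the image of the basis row [delta_mx 0 a], which lies in the strand of degree
    [sr_deg a]; exactness of that strand then kills it. *)
Lemma sr_diff_diff i : sr_diff G i.+1 *m sr_diff G i = 0.
Proof.
apply/row_matrixP => a; rewrite row_mul row0.
have /graded_row g := @sr_diff_graded G i.+1.
apply/(sr_exact (g a)); exists (delta_mx 0 a); last by rewrite rowE.
move=> j; rewrite mxE eqxx /=; case: (j =P a) => [->|_]; last by rewrite eqxx.
by move=> _; apply: lepm_refl.
Qed.

Lemma sr_diff_aug a : sr_deg a = 0%MM -> row a (sr_diff G 0) *m sr_aug G = 0.
Proof.
move=> a0; have /graded_row g := @sr_diff_graded G 0.
have [_ H] := sr_exact0 (g a); apply: H => //.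
exists (delta_mx 0 a); last by rewrite rowE.
move=> j; rewrite mxE eqxx /=; case: (j =P a) => [->|_]; last by rewrite eqxx.
by move=> _; apply: lepm_refl.
Qed.

End Lifting.

(** * Chain maps, homotopies and independence of the resolution *)

Definition chain_map (F G : strand_resolution)
    (phi : forall i, 'M[k]_(sr_rank F i, sr_rank G i)) : Prop :=
  [/\ forall i, graded (@sr_deg F i) (@sr_deg G i) (phi i),
      forall i, phi i.+1 *m sr_diff G i = sr_diff F i *m phi i
    & phi 0%N *m sr_aug G = sr_aug F].

Lemma chain_map_exists F G : exists phi, @chain_map F G phi.
Proof.
have [v0 sv0 v0G] := sr_aug_surj G.
(* The second clause makes the next square solvable. The third concerns index 0 only; the cast along
   [e : i = 0] lets it live in a predicate indexed by [i]. *)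
pose P i (phi : 'M[k]_(sr_rank F i, sr_rank G i)) :=
  [/\ graded (@sr_deg F i) (@sr_deg G i) phi,
      exists2 psi, graded (@sr_deg F i.+1) (@sr_deg G i.+1) psi
                 & sr_diff F i *m phi = psi *m sr_diff G i
    & forall e : i = 0%N, castmx (congr1 (sr_rank F) e, congr1 (sr_rank G) e) phi
        *m sr_aug G = sr_aug F].
pose R i (phi : 'M[k]_(sr_rank F i, sr_rank G i))
  (psi : 'M[k]_(sr_rank F i.+1, sr_rank G i.+1)) :=
  psi *m sr_diff G i = sr_diff F i *m phi.
have [||phi [phiP phiR]] := @dependent_choice_nat _ P R.
(* Each basis element goes to its augmentation times a fixed lift [v0] of 1. Nonzero augmentations
   occur in degree 0 only, and [v0] is supported there, so [phi] is graded. *)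
- pose phi := sr_aug F *m v0.
  have gphi : graded (@sr_deg F 0) (@sr_deg G 0) phi.
    move=> a b; rewrite mxE big_ord1 mulf_eq0 negb_or => /andP[/sr_aug_deg-> /sv0].
    by [].
  have phiG : phi *m sr_aug G = sr_aug F by rewrite -mulmxA v0G mulmx1.
  exists phi; split=> [//||e]; last by rewrite (eq_irrelevance e erefl) castmx_id.
  apply: lift0 => [|a a0]; first by apply: gradedM gphi; apply: sr_diff_graded.
  by rewrite -row_mul -mulmxA phiG row_mul sr_diff_aug.
- move=> i phi [gphi [psi gpsi psiE] _]; exists psi; first exact: esym.
  split=> //; apply: liftS; first by apply: gradedM gpsi; apply: sr_diff_graded.
  by rewrite -mulmxA -psiE mulmxA sr_diff_diff mul0mx.
exists phi; split=> [i|i|]; first by case: (phiP i).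
- exact: phiR.
- by have [_ _ /(_ erefl)] := phiP 0%N; rewrite castmx_id.
Qed.

Lemma chain_map_comp F G H phi psi :
  @chain_map F G phi -> @chain_map G H psi -> @chain_map F H (fun i => phi i *m psi i).
Proof.
move=> [gphi dphi aphi] [gpsi dpsi apsi]; split=> [i|i|].
- exact: gradedM (gphi i) (gpsi i).
- by rewrite -mulmxA dpsi !mulmxA dphi.
- by rewrite -mulmxA apsi.
Qed.

Lemma chain_map_homotopy F (theta : forall i, 'M[k]_(sr_rank F i)) :
  @chain_map F F theta ->
  exists h : forall i, 'M[k]_(sr_rank F i, sr_rank F i.+1),
  [/\ forall i, graded (@sr_deg F i) (@sr_deg F i.+1) (h i),
      1%:M - theta 0%N = h 0%N *m sr_diff F 0
    & forall i, 1%:M - theta i.+1 = sr_diff F i *m h i + h i.+1 *m sr_diff F i.+1].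
Proof.
move=> [gt dt at0].
pose om i := 1%:M - theta i.
have gom i : graded (@sr_deg F i) (@sr_deg F i) (om i).
  by apply: gradedB; [apply: graded1 | apply: gt].
have dom i : om i.+1 *m sr_diff F i = sr_diff F i *m om i.
  by rewrite mulmxBl mulmxBr mul1mx mulmx1 dt.
(* By [dom], the second clause says exactly that [om i.+1 - sr_diff F i *m h] is killed by
   [sr_diff F i], so that [liftS] yields the next [h']. *)
pose P i (h : 'M[k]_(sr_rank F i, sr_rank F i.+1)) :=
  [/\ graded (@sr_deg F i) (@sr_deg F i.+1) h,
      sr_diff F i *m (om i - h *m sr_diff F i) = 0
    & forall e : i = 0%N,
        castmx (congr1 (sr_rank F) e, congr1 (fun j => sr_rank F j.+1) e) h
        *m sr_diff F 0 = om 0%N].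
pose R i (h : 'M[k]_(sr_rank F i, sr_rank F i.+1))
  (h' : 'M[k]_(sr_rank F i.+1, sr_rank F i.+2)) :=
  om i.+1 = sr_diff F i *m h + h' *m sr_diff F i.+1.
have [||h [hP hR]] := @dependent_choice_nat _ P R.
- have [|h gh hE] := @lift0 F _ (@sr_deg F 0) (om 0%N) (gom 0%N).
    by move=> a _; rewrite -row_mul mulmxBl mul1mx at0 subrr row0.
  exists h; split=> [//||e]; first by rewrite hE subrr mulmx0.
  by rewrite (eq_irrelevance e erefl) castmx_id.
- move=> i h [gh hE _].
  have [||h' gh' h'E] := @liftS F _ (@sr_deg F i.+1) i (om i.+1 - sr_diff F i *m h).
  + by apply: gradedB => //; apply: gradedM gh; apply: sr_diff_graded.
  + by rewrite mulmxBl dom -mulmxA -mulmxBr.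
  exists h'; first by rewrite /R -h'E addrC subrK.
  split=> //; rewrite -h'E opprB addrCA subrr addr0 mulmxA sr_diff_diff mul0mx //.
exists h; split=> [i||i]; first by case: (hP i).
- by have [_ _ /(_ erefl)] := hP 0%N; rewrite castmx_id.
- exact: hR.
Qed.

Lemma chain_map_cycle F G phi s i v :
  downset s -> @chain_map F G phi ->
  @strand_cycle F s i v -> @strand_cycle G s i (v *m phi i).
Proof.
move=> ds [gphi dphi _]; case: i v => [|i] v /=; first exact: supported_mul.
move=> [sv v0]; split; first exact: supported_mul sv.
by rewrite -mulmxA dphi mulmxA v0 mul0mx.
Qed.

Lemma chain_map_boundary F G phi s i v :
  downset s -> @chain_map F G phi ->
  @strand_boundary F s i v -> @strand_boundary G s i (v *m phi i).
Proof.
move=> ds [gphi dphi _] [w sw ->]; exists (w *m phi i.+1); first exact: supported_mul sw.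
by rewrite -!mulmxA dphi.
Qed.

Lemma chain_map_homotopic_id F theta s i v :
  downset s -> @chain_map F F theta -> @strand_cycle F s i v ->
  strand_boundary s (v - v *m theta i).
Proof.
move=> ds /chain_map_homotopy[h [gh h0 hS]] Zv.
exists (v *m h i); first exact: supported_mul (strand_cycle_supported Zv).
rewrite -{1}[v]mulmx1 -mulmxBr; case: i v Zv => [|i] v; first by rewrite h0 mulmxA.
by move=> [_ v0]; rewrite hS mulmxDr mulmxA v0 mul0mx add0r mulmxA.
Qed.

Lemma strand_dim_unique F G s i d : downset s -> strand_dim F s i d -> strand_dim G s i d.
Proof.
move=> ds.
have [phi cphi] := chain_map_exists F G; have [psi cpsi] := chain_map_exists G F.
apply: (@strand_dim_transfer F s i d _ _ _ (phi i) (psi i)).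
- exact: strand_boundary0.
- exact: strand_boundaryB.
- exact: strand_boundaryZ.
- by move=> v; apply: chain_map_cycle.
- by move=> v; apply: chain_map_cycle.
- by move=> v; apply: chain_map_boundary.
- by move=> v; apply: chain_map_boundary.
- move=> v Zv; rewrite -mulmxA.
  exact: (chain_map_homotopic_id ds (chain_map_comp cphi cpsi)).
- move=> v Zv; rewrite -mulmxA.
  exact: (chain_map_homotopic_id ds (chain_map_comp cpsi cphi)).
Qed.

End Strands.

(** * From polynomial rows to strands *)

Lemma mcoeffMX_notin (k : fieldType) (n : nat) (p : {mpoly k[n]}) (w u : 'X_{1..n}) :
  ~~ (w <= u)%MM -> (p * 'X_[w])@_u = 0.
Proof.
move=> Nle; apply: memN_msupp_eq0; rewrite (perm_mem (msuppMX p w)).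
by apply: contra Nle => /mapP[v _ ->]; rewrite lem_addr.
Qed.

Lemma mcoeffMX_le (k : fieldType) (n : nat) (p : {mpoly k[n]}) (w u : 'X_{1..n}) :
  (w <= u)%MM -> (p * 'X_[w])@_u = p@_(u - w).
Proof. by move=> /submK {1}<-; rewrite addmC mcoeffMX. Qed.

Lemma subm_subm n (a b u : 'X_{1..n}) :
  (b <= a)%MM -> (a <= u)%MM -> (u - b - (a - b) = u - a)%MM.
Proof.
move=> /mnm_lepP ba /mnm_lepP au; apply/mnmP => i; rewrite !mnmBE.
by rewrite subnBA // subnK // (leq_trans (ba i)).
Qed.

Lemma subm_addm n (a b u : 'X_{1..n}) :
  (b <= a)%MM -> (a <= u)%MM -> (u - a + (a - b) = u - b)%MM.
Proof.
move=> /mnm_lepP ba /mnm_lepP au; apply/mnmP => i; rewrite mnmDE !mnmBE.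
by rewrite addnBA // subnK.
Qed.

Lemma lem_subm_subm n (a b u : 'X_{1..n}) :
  (b <= a)%MM -> (b <= u)%MM -> (a - b <= u - b)%MM = (a <= u)%MM.
Proof.
move=> /mnm_lepP ba /mnm_lepP bu; apply/mnm_lepP/mnm_lepP => H i; move: (H i).
  by rewrite !mnmBE leq_subLR subnKC.
by move=> le; rewrite !mnmBE leq_sub2r.
Qed.

Lemma scalar_mx1_inj (k : fieldType) : injective (fun a : k => a%:M : 'M_1).
Proof. by move=> a b /matrixP/(_ 0 0); rewrite !mxE. Qed.

Section Translation.
Variables (k : fieldType) (n : nat).
Local Notation mnm := 'X_{1..n}.
Local Notation R := {mpoly k[n]}.

(** Subtraction of exponents is truncated, so without the test a coefficient would be read in a
    wrong degree. [of_strand] has no test: its lemmas assume support below [u] where this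
    matters. *)
Definition strand_of r (dg : 'I_r -> mnm) (u : mnm) (v : 'rV[R]_r) : 'rV[k]_r :=
  \row_j (if (dg j <= u)%MM then (v 0 j)@_(u - dg j) else 0).

Definition of_strand r (dg : 'I_r -> mnm) (u : mnm) (c : 'rV[k]_r) : 'rV[R]_r :=
  \row_j (c 0 j *: 'X_[u - dg j]).

Definition homogenize p q (dp : 'I_p -> mnm) (dq : 'I_q -> mnm) (M : 'M[k]_(p, q)) :
    'M[R]_(p, q) :=
  \matrix_(a, b) (M a b *: 'X_[dp a - dq b]).

Lemma strand_ofB r (dg : 'I_r -> mnm) u : {morph strand_of dg u : x y / x - y}.
Proof.
move=> x y; apply/rowP=> j; rewrite !mxE mcoeffB.
by case: ifP; rewrite ?subrr.
Qed.

Lemma strand_ofZ r (dg : 'I_r -> mnm) u c :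
  {morph strand_of dg u : x / c%:MP *: x >-> c *: x}.
Proof.
by move=> x; apply/rowP=> j; rewrite !mxE mcoeffCM; case: ifP; rewrite ?mulr0.
Qed.

Lemma of_strandB r (dg : 'I_r -> mnm) u : {morph of_strand dg u : x y / x - y}.
Proof. by move=> x y; apply/rowP=> j; rewrite !mxE scalerBl. Qed.

Lemma of_strandZ r (dg : 'I_r -> mnm) u c :
  {morph of_strand dg u : x / c *: x >-> c%:MP *: x}.
Proof. by move=> x; apply/rowP=> j; rewrite !mxE mul_mpolyC scalerA. Qed.

Lemma supported_strand_of r (dg : 'I_r -> mnm) u v :
  supported (below u) dg (strand_of dg u v).
Proof. by move=> j; rewrite mxE; case: ifP => // _; rewrite eqxx. Qed.

Lemma of_strandK r (dg : 'I_r -> mnm) u c :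
  supported (below u) dg c -> strand_of dg u (of_strand dg u c) = c.
Proof.
move=> sc; apply/rowP=> j; rewrite !mxE; have [c0|/sc le] := eqVneq (c 0 j) 0.
  by rewrite c0 scale0r mcoeff0; case: ifP.
by move: le; rewrite /below => ->; rewrite mcoeffZ mcoeffX eqxx mulr1.
Qed.

Lemma strand_of_homogenize p q (dp : 'I_p -> mnm) (dq : 'I_q -> mnm) M u v :
  graded dp dq M ->
  strand_of dq u (v *m homogenize dp dq M) = strand_of dp u v *m M.
Proof.
move=> gM; apply/rowP=> b; rewrite !mxE.
transitivity (if (dq b <= u)%MM then
   \sum_j (v 0 j * homogenize dp dq M j b)@_(u - dq b) else 0).
  by case: ifP => // _; rewrite raddf_sum.
have -> : (if (dq b <= u)%MM then
   \sum_j (v 0 j * homogenize dp dq M j b)@_(u - dq b) else 0) =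
   \sum_j (if (dq b <= u)%MM then (v 0 j * homogenize dp dq M j b)@_(u - dq b) else 0).
  by case: ifP => // _; rewrite big1.
apply: eq_bigr => a _; rewrite !mxE.
have [M0|/gM le_ba] := eqVneq (M a b) 0.
  by rewrite M0 scale0r mulr0 mcoeff0 mulr0; case: ifP.
rewrite -scalerAr mcoeffZ; case: ifPn => [le_bu|Nle_bu]; last first.
  case: ifPn => [le_au|_]; last by rewrite mul0r.
  by rewrite (lepm_trans le_ba le_au) in Nle_bu.
case: ifPn => [le_au|Nle_au].
  by rewrite mcoeffMX_le ?lem_subm_subm // subm_subm // mulrC.
by rewrite mcoeffMX_notin ?lem_subm_subm // mulr0 mul0r.
Qed.

Lemma of_strand_homogenize p q (dp : 'I_p -> mnm) (dq : 'I_q -> mnm) M u c :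
  graded dp dq M -> supported (below u) dp c ->
  of_strand dp u c *m homogenize dp dq M = of_strand dq u (c *m M).
Proof.
move=> gM sc; apply/rowP=> b; rewrite !mxE scaler_suml; apply: eq_bigr => a _.
rewrite !mxE; have [c0|/sc le_au] := eqVneq (c 0 a) 0.
  by rewrite c0 mul0r !scale0r mul0r.
have [M0|/gM le_ba] := eqVneq (M a b) 0; first by rewrite M0 mulr0 !scale0r mulr0.
by rewrite -scalerAl -scalerAr scalerA -mpolyXD subm_addm.
Qed.

Lemma homogeneous_of_strand r (dg : 'I_r -> mnm) u c :
  supported (below u) dg c -> homogeneous dg u (of_strand dg u c).
Proof.
move=> sc j w; rewrite mxE; have [c0|/sc le] := eqVneq (c 0 j) 0.
  by rewrite c0 scale0r msupp0.
by move=> /msuppZ_le; rewrite msuppX inE => /eqP->; apply: submK.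
Qed.

Lemma strand_ofK r (dg : 'I_r -> mnm) u v :
  homogeneous dg u v -> of_strand dg u (strand_of dg u v) = v.
Proof.
move=> hv; apply/rowP=> j; rewrite !mxE; apply/mpolyP => w.
rewrite mcoeffZ mcoeffX.
have [/hv <-|Nw] := boolP (w \in msupp (v 0 j)).
  by rewrite lem_addl addmK eqxx mulr1.
rewrite (memN_msupp_eq0 Nw); case: eqP => [->|_]; last by rewrite mulr0.
by rewrite mulr1 (memN_msupp_eq0 Nw); case: ifP.
Qed.

Definition degrees r (dg : 'I_r -> mnm) (v : 'rV[R]_r) : seq mnm :=
  undup (flatten [seq [seq (w + dg j)%MM | w <- msupp (v 0 j)] | j <- enum 'I_r]).

Lemma sum_strands r (dg : 'I_r -> mnm) v :
  v = \sum_(u <- degrees dg v) of_strand dg u (strand_of dg u v).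
Proof.
apply/rowP=> j; apply/mpolyP=> w; rewrite summxE raddf_sum /=.
have E u : ((of_strand dg u (strand_of dg u v)) 0 j)@_w
         = if u == (w + dg j)%MM then (v 0 j)@_w else 0.
  rewrite !mxE mcoeffZ mcoeffX; case: (u =P (w + dg j)%MM) => [->|neq].
    by rewrite lem_addl addmK eqxx mulr1.
  case: ifP => [/submK le|_]; last by rewrite mul0r.
  by case: eqP => [e|_]; rewrite ?mulr0 //; case: neq; rewrite -le e.
under eq_bigr do rewrite E.
have [Lw|Lw] := boolP ((w + dg j)%MM \in degrees dg v).
  rewrite (bigD1_seq _ Lw) ?undup_uniq //= eqxx big1 ?addr0 // => u /negPf-> //.
rewrite big1_seq => [|u /andP[_ Lu]]; last first.
  by case: eqP => // e; rewrite -e Lu in Lw.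
apply: memN_msupp_eq0; apply: contra Lw => wj.
rewrite mem_undup; apply/flattenP.
exists [seq (w + dg j)%MM | w <- msupp (v 0 j)]; last exact: map_f.
by apply: map_f; rewrite mem_enum.
Qed.

Lemma strand_of_inj r (dg : 'I_r -> mnm) v :
  (forall u, strand_of dg u v = 0) -> v = 0.
Proof.
move=> v0; rewrite (sum_strands dg v) big1 // => u _; rewrite v0.
by apply/rowP=> j; rewrite !mxE scale0r.
Qed.

(** A row has finitely many nonzero homogeneous components, and preimages found component by
    component add up. This turns exactness of strands into exactness on arbitrary polynomial
    rows. *)
Lemma homogenize_image p q (dp : 'I_p -> mnm) (dq : 'I_q -> mnm) M v :
  graded dp dq M ->
  (forall u, exists2 w, supported (below u) dp w & strand_of dq u v = w *m M) ->
  exists w, v = w *m homogenize dp dq M.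
Proof.
move=> gM imv; rewrite (sum_strands dq v); elim: (degrees dq v) => [|u L [w IH]].
  by exists 0; rewrite big_nil mul0mx.
have [wu su vu] := imv u; exists (of_strand dp u wu + w).
by rewrite big_cons mulmxDl IH of_strand_homogenize // vu.
Qed.

Definition dehomogenize p q (dp : 'I_p -> mnm) (dq : 'I_q -> mnm) (M : 'M[R]_(p, q)) :
    'M[k]_(p, q) :=
  \matrix_a strand_of dq (dp a) (row a M).

Lemma graded_dehomogenize p q (dp : 'I_p -> mnm) (dq : 'I_q -> mnm) M :
  graded dp dq (dehomogenize dp dq M).
Proof. by apply/graded_row=> a; rewrite rowK; apply: supported_strand_of. Qed.

Lemma dehomogenizeK p q (dp : 'I_p -> mnm) (dq : 'I_q -> mnm) M :
  (forall a, homogeneous dq (dp a) (row a M)) ->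
  homogenize dp dq (dehomogenize dp dq M) = M.
Proof.
move=> hM; apply/row_matrixP=> a; rewrite -[RHS](strand_ofK (hM a)).
by apply/rowP=> b; rewrite !mxE.
Qed.

Lemma homogenize_homogeneous p q (dp : 'I_p -> mnm) (dq : 'I_q -> mnm) D a :
  graded dp dq D -> homogeneous dq (dp a) (row a (homogenize dp dq D)).
Proof.
move=> /graded_row gD; have -> : row a (homogenize dp dq D) = of_strand dq (dp a) (row a D).
  by apply/rowP=> b; rewrite !mxE.
exact: homogeneous_of_strand.
Qed.

Lemma meval0E (p : R) : p.@[fun=> 0] = p@_0.
Proof.
rewrite mevalE.
have E m : p@_m * \prod_(i < n) (0 : k) ^+ m i = if m == 0%MM then p@_0 else 0.
  case: eqP => [->|/eqP].
    by rewrite big1 ?mulr1 // => i _; rewrite mnm0E expr0.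
  rewrite -mdeg_eq0 mdegE sum_nat_eq0 => /forallPn[i /= mi].
  by rewrite (bigD1 i) //= expr0n (negPf mi) mul0r mulr0.
under eq_bigr do rewrite E.
have [p0|p0] := boolP (0%MM \in msupp p).
  by rewrite (bigD1_seq _ p0) //= eqxx big1 ?addr0 // => m /negPf->.
rewrite (memN_msupp_eq0 p0) big1 // => m _; by case: ifP.
Qed.

(** Evaluation at the origin reads the constant coefficient, and only basis elements of degree 0
    have nonzero augmentation; so only the degree-0 strand of [v] is seen. *)
Lemma augment_strandE r (dg : 'I_r -> mnm) (aug : 'I_r -> k) (v : 'rV[R]_r) :
  (forall j, aug j != 0 -> dg j = 0%MM) ->
  (\sum_j (v 0 j).@[fun=> 0] * aug j)%:M = strand_of dg 0 v *m \col_j aug j.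
Proof.
move=> hd; apply/matrixP=> a b; rewrite !ord1 !mxE eqxx mulr1n; apply: eq_bigr => j _.
rewrite !mxE meval0E; have [->|/hd->] := eqVneq (aug j) 0; first by rewrite !mulr0.
by rewrite lepm_refl subm0.
Qed.

Lemma strand_of_of_strand_aug r (dg : 'I_r -> mnm) (aug : 'cV[k]_r) u c :
  (forall j, aug j 0 != 0 -> dg j = 0%MM) ->
  strand_of dg 0 (of_strand dg u c) *m aug = if u == 0%MM then c *m aug else 0.
Proof.
move=> hd; apply/matrixP=> a b; rewrite !ord1 mxE.
transitivity (\sum_j if u == 0%MM then c 0 j * aug j 0 else 0); last first.
  by case: ifP => _; rewrite mxE // big1.
apply: eq_bigr => j _; rewrite !mxE.
have [->|/hd->] := eqVneq (aug j 0) 0; first by rewrite !mulr0; case: ifP.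
rewrite lepm_refl !subm0 mcoeffZ mcoeffX; case: ifP; by rewrite ?mulr1 ?mulr0 ?mul0r.
Qed.

(** * Polynomial resolutions as strand resolutions *)

Section Strandwise.
Variable F : free_resolution k n.

Definition fr_scalar_diff i : 'M[k]_(fr_rank F i.+1, fr_rank F i) :=
  dehomogenize (@fr_deg _ _ F i.+1) (@fr_deg _ _ F i) (fr_diff F i).

Lemma fr_scalar_diff_graded i :
  graded (@fr_deg _ _ F i.+1) (@fr_deg _ _ F i) (fr_scalar_diff i).
Proof. exact: graded_dehomogenize. Qed.

Lemma fr_scalar_diffK i :
  fr_diff F i = homogenize (@fr_deg _ _ F i.+1) (@fr_deg _ _ F i) (fr_scalar_diff i).
Proof. by rewrite dehomogenizeK // => a; apply: fr_diff_homogeneous. Qed.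

Definition fr_aug_col : 'cV[k]_(fr_rank F 0) := \col_j @fr_aug _ _ F j.

Lemma fr_aug_col_deg j : fr_aug_col j 0 != 0 -> fr_deg j = 0%MM.
Proof. by rewrite mxE; apply: fr_aug_homogeneous. Qed.

Lemma fr_augmentE v :
  (fr_augment v)%:M = strand_of (@fr_deg _ _ F 0) 0 v *m fr_aug_col.
Proof. exact/augment_strandE/fr_aug_homogeneous. Qed.

Lemma fr_scalar_aug_surj :
  exists2 v, supported (below 0%MM) (@fr_deg _ _ F 0) v & v *m fr_aug_col = 1%:M.
Proof.
have [v v1] := fr_aug_surj F 1; exists (strand_of (@fr_deg _ _ F 0) 0 v).
  exact: supported_strand_of.
by rewrite -fr_augmentE v1.
Qed.

Lemma fr_scalar_exact0 u v : supported (below u) (@fr_deg _ _ F 0) v ->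
  (u = 0%MM -> v *m fr_aug_col = 0) <->
  (exists2 w, supported (below u) (@fr_deg _ _ F 1) w & v = w *m fr_scalar_diff 0).
Proof.
move=> sv; have gF := fr_scalar_diff_graded.
have augE : (fr_augment (of_strand (@fr_deg _ _ F 0) u v))%:M
          = if u == 0%MM then v *m fr_aug_col else 0.
  by rewrite fr_augmentE strand_of_of_strand_aug //; apply: fr_aug_col_deg.
split=> [v0|[w sw vE] u0].
  have /fr_exact0[w wE] : fr_augment (of_strand (@fr_deg _ _ F 0) u v) = 0.
    apply: scalar_mx1_inj; rewrite augE raddf0.
    by case: eqP => // /v0.
  (* The polynomial preimage [w] may be inhomogeneous; its component of degree [u] is a preimage in
     the strand. *)
  exists (strand_of (@fr_deg _ _ F 1) u w); first exact: supported_strand_of.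
  have := strand_of_homogenize u w (@fr_scalar_diff_graded 0).
  by rewrite -fr_scalar_diffK -wE of_strandK.
move: augE; rewrite u0 eqxx => <-; rewrite -u0.
have -> : fr_augment (of_strand (@fr_deg _ _ F 0) u v) = 0.
  apply/fr_exact0; exists (of_strand (@fr_deg _ _ F 1) u w).
  by rewrite fr_scalar_diffK of_strand_homogenize // -vE.
exact: raddf0.
Qed.

Lemma fr_scalar_exact i u v : supported (below u) (@fr_deg _ _ F i.+1) v ->
  v *m fr_scalar_diff i = 0 <->
  (exists2 w, supported (below u) (@fr_deg _ _ F i.+2) w & v = w *m fr_scalar_diff i.+1).
Proof.
move=> sv; have gF := fr_scalar_diff_graded.
split=> [v0|[w sw vE]].
  have /fr_exact[w wE] : of_strand (@fr_deg _ _ F i.+1) u v *m fr_diff F i = 0.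
    rewrite fr_scalar_diffK of_strand_homogenize // v0.
    by apply/rowP=> j; rewrite !mxE scale0r.
  exists (strand_of (@fr_deg _ _ F i.+2) u w); first exact: supported_strand_of.
  have := strand_of_homogenize u w (gF i.+1).
  by rewrite -fr_scalar_diffK -wE of_strandK.
have E : of_strand (@fr_deg _ _ F i.+1) u v *m fr_diff F i = 0.
  apply/fr_exact; exists (of_strand (@fr_deg _ _ F i.+2) u w).
  by rewrite fr_scalar_diffK of_strand_homogenize // -vE.
move: E; rewrite fr_scalar_diffK => /(congr1 (strand_of (@fr_deg _ _ F i) u)).
rewrite strand_of_homogenize // of_strandK // => ->.
by apply/rowP=> j; rewrite !mxE mcoeff0; case: ifP.
Qed.

Definition strand_resolution_of : strand_resolution k n :=
  StrandResolution fr_scalar_diff_graded fr_aug_col_deg fr_scalar_aug_surj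
    fr_scalar_exact0 fr_scalar_exact.

End Strandwise.

(** * Strand resolutions as polynomial resolutions *)

Section Realization.
Variable G : strand_resolution k n.
Local Notation deg := (@sr_deg _ _ G).

Definition sr_poly_diff i : 'M[R]_(sr_rank G i.+1, sr_rank G i) :=
  homogenize (@deg i.+1) (@deg i) (sr_diff G i).

Lemma sr_augmentE (v : 'rV[R]_(sr_rank G 0)) :
  (\sum_j (v 0 j).@[fun=> 0] * sr_aug G j 0)%:M = strand_of (@deg 0) 0 v *m sr_aug G.
Proof.
rewrite (@augment_strandE _ (@deg 0)); last exact: sr_aug_deg.
by congr (_ *m _); apply/colP=> j; rewrite mxE.
Qed.

Lemma sr_poly_aug_surj c : exists v : 'rV[R]_(sr_rank G 0),
  \sum_j (v 0 j).@[fun=> 0] * sr_aug G j 0 = c.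
Proof.
have [v sv v1] := sr_aug_surj G; exists (of_strand (@deg 0) 0 (c *: v)).
apply: scalar_mx1_inj; rewrite sr_augmentE of_strandK; last exact: supportedZ.
by rewrite -scalemxAl v1 scale_scalar_mx mulr1.
Qed.

Lemma sr_poly_exact0 (v : 'rV[R]_(sr_rank G 0)) :
  \sum_j (v 0 j).@[fun=> 0] * sr_aug G j 0 = 0 <->
  exists w, v = w *m sr_poly_diff 0.
Proof.
split=> [v0|[w ->]].
  apply: homogenize_image => [|u]; first exact: sr_diff_graded.
  apply/sr_exact0 => [|->]; first exact: supported_strand_of.
  by rewrite -sr_augmentE v0; apply: raddf0.
apply: scalar_mx1_inj; rewrite sr_augmentE; rewrite [RHS]raddf0.
rewrite strand_of_homogenize; last exact: sr_diff_graded.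
have sw := @supported_strand_of _ (@deg 1) 0 w.
have /sr_exact0[_ H] := supported_mul (@below_downset _ _) (@sr_diff_graded _ _ G 0) sw.
by apply: H => //; exists (strand_of (@deg 1) 0 w).
Qed.

Lemma sr_poly_exact i (v : 'rV[R]_(sr_rank G i.+1)) :
  v *m sr_poly_diff i = 0 <-> exists w, v = w *m sr_poly_diff i.+1.
Proof.
have gG := @sr_diff_graded _ _ G.
have strand0 r (dg : 'I_r -> mnm) u : strand_of dg u 0 = 0.
  by apply/rowP=> j; rewrite !mxE mcoeff0; case: ifP.
split=> [v0|[w ->]].
  apply: homogenize_image => // u.
  apply/sr_exact; first exact: supported_strand_of.
  by rewrite -(strand_of_homogenize _ _ (gG i)) -/(sr_poly_diff i) v0.
apply: (@strand_of_inj _ (@deg i)) => u.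
by rewrite !strand_of_homogenize // -mulmxA sr_diff_diff mulmx0.
Qed.

Definition free_resolution_of : free_resolution k n :=
  @FreeResolution k n (sr_rank G) deg sr_poly_diff (fun j => sr_aug G j 0)
    (fun i a => @homogenize_homogeneous _ _ _ _ _ a (@sr_diff_graded _ _ G i))
    (@sr_aug_deg _ _ G) sr_poly_aug_surj sr_poly_exact0 sr_poly_exact.

End Realization.

(** * Tor of an ideal in terms of strands *)

Record ideal (J : R -> Prop) : Prop := Ideal {
  ideal0 : J 0;
  idealD : forall p q, J p -> J q -> J (p + q);
  idealM : forall p q, J q -> J (p * q)
}.

(* The basis degrees contributing to the multidegree m of F (x) J. *)
Definition contributes (J : R -> Prop) (m : mnm) : mnm -> Prop :=
  fun u => (u <= m)%MM /\ J 'X_[m - u].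

(** If w divides u, then x^(m-w) is x^(u-w) times x^(m-u), hence stays in [J]. *)
Lemma contributes_downset J m : ideal J -> downset (contributes J m).
Proof.
move=> iJ u w le_wu [le_um Ju]; split; first exact: lepm_trans le_um.
by rewrite -(subm_addm le_wu le_um) mpolyXD mulrC; apply: (idealM iJ).
Qed.

Lemma tor_chain_of_strand (F : free_resolution k n) J m i c :
  ideal J -> supported (contributes J m) (@fr_deg _ _ F i) c ->
  tor_chain J m (of_strand (@fr_deg _ _ F i) m c).
Proof.
move=> iJ sc; split; last by apply: homogeneous_of_strand => j /sc[].
move=> j; rewrite mxE; have [->|/sc[_ Jj]] := eqVneq (c 0 j) 0.
  by rewrite scale0r; apply: ideal0.
by rewrite -mul_mpolyC; apply: idealM.
Qed.

Lemma supported_tor_chain (F : free_resolution k n) J m i v :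
  ideal J -> @tor_chain _ _ F J i m v ->
  supported (contributes J m) (@fr_deg _ _ F i) (strand_of (@fr_deg _ _ F i) m v).
Proof.
move=> iJ [Jv hv] j; rewrite mxE; case: ifP => [le nz|]; last by rewrite eqxx.
(* By homogeneity the entry is its coefficient times x^(m - deg j); multiplying by the inverse of
   the nonzero coefficient leaves the monomial in [J]. *)
split=> //; have := Jv j; rewrite -{1}(strand_ofK hv) !mxE le => /(idealM iJ (_^-1)%:MP).
move=> /(_ ((v 0 j)@_(m - fr_deg j))).
by rewrite mul_mpolyC scalerA mulVf // scale1r.
Qed.

Lemma of_strand_cycle (F : free_resolution k n) J m i c :
  ideal J -> @strand_cycle _ _ (strand_resolution_of F) (contributes J m) i c ->
  tor_cycle J m (of_strand (@fr_deg _ _ F i) m c).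
Proof.
move=> iJ; case: i c => [|i] c; first exact: tor_chain_of_strand.
move=> [/= sc c0]; split; first exact: tor_chain_of_strand.
rewrite fr_scalar_diffK of_strand_homogenize ?c0.
- by apply/rowP=> j; rewrite !mxE scale0r.
- exact: fr_scalar_diff_graded.
- by move=> j /sc[].
Qed.

Lemma strand_of_cycle (F : free_resolution k n) J m i v :
  ideal J -> @tor_cycle _ _ F J i m v ->
  @strand_cycle _ _ (strand_resolution_of F) (contributes J m) i
    (strand_of (@fr_deg _ _ F i) m v).
Proof.
move=> iJ; case: i v => [|i] v; first exact: supported_tor_chain.
move=> [sv v0]; split; first exact: supported_tor_chain.
rewrite -(strand_of_homogenize _ _ (@fr_scalar_diff_graded F i)) -fr_scalar_diffK v0.
by apply/rowP=> j; rewrite !mxE mcoeff0; case: ifP.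
Qed.

Lemma of_strand_boundary (F : free_resolution k n) J m i c :
  ideal J -> @strand_boundary _ _ (strand_resolution_of F) (contributes J m) i c ->
  tor_boundary J m (of_strand (@fr_deg _ _ F i) m c).
Proof.
move=> iJ [w sw ->]; exists (of_strand (@fr_deg _ _ F i.+1) m w).
  exact: tor_chain_of_strand.
rewrite fr_scalar_diffK of_strand_homogenize //; first exact: fr_scalar_diff_graded.
by move=> j /sw[].
Qed.

Lemma strand_of_boundary (F : free_resolution k n) J m i v :
  ideal J -> @tor_boundary _ _ F J i m v ->
  @strand_boundary _ _ (strand_resolution_of F) (contributes J m) i
    (strand_of (@fr_deg _ _ F i) m v).
Proof.
move=> iJ [w cw ->]; exists (strand_of (@fr_deg _ _ F i.+1) m w).
  exact: supported_tor_chain.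
rewrite fr_scalar_diffK strand_of_homogenize //; exact: fr_scalar_diff_graded.
Qed.

Lemma tor_cycle_chain (F : free_resolution k n) J m i v :
  @tor_cycle _ _ F J i m v -> tor_chain J m v.
Proof. by case: i v => [|i] v // []. Qed.

Lemma tor_chainB (F : free_resolution k n) J m i v w : ideal J ->
  @tor_chain _ _ F J i m v -> @tor_chain _ _ F J i m w -> @tor_chain _ _ F J i m (v - w).
Proof.
move=> iJ cv cw; rewrite -(strand_ofK cv.2) -(strand_ofK cw.2) -of_strandB.
by apply: tor_chain_of_strand => //; apply: supportedB; apply: supported_tor_chain.
Qed.

Lemma tor_chainZ (F : free_resolution k n) J m i c v : ideal J ->
  @tor_chain _ _ F J i m v -> @tor_chain _ _ F J i m (c%:MP *: v).
Proof.
move=> iJ cv; rewrite -(strand_ofK cv.2) -of_strandZ.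
by apply: tor_chain_of_strand => //; apply: supportedZ; apply: supported_tor_chain.
Qed.

Lemma quotient_dim_strand (F : free_resolution k n) J m i d : ideal J ->
  quotient_dim (@tor_cycle _ _ F J i m) (@tor_boundary _ _ F J i m) d <->
  strand_dim (strand_resolution_of F) (contributes J m) i d.
Proof.
move=> iJ.
have B0 : @tor_boundary _ _ F J i m 0.
  exists 0; last by rewrite mul0mx.
  by split=> [j|j u]; rewrite mxE ?msupp0 //; apply: ideal0.
have BB x y : @tor_boundary _ _ F J i m x -> @tor_boundary _ _ F J i m y ->
    @tor_boundary _ _ F J i m (x - y).
  move=> [v cv ->] [w cw ->]; exists (v - w); last by rewrite mulmxBl.
  exact: tor_chainB.
have BZ (c : k) x : @tor_boundary _ _ F J i m x -> @tor_boundary _ _ F J i m (c%:MP *: x).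
  move=> [v cv ->]; exists (c%:MP *: v); last by rewrite -scalemxAl.
  exact: tor_chainZ.
split.
  apply: (@quotient_dim_transfer k _ _ (fun c v => c%:MP *: v) (fun c v => c *: v)
    _ _ _ _ (strand_of (@fr_deg _ _ F i) m) (of_strand (@fr_deg _ _ F i) m)) => //.
  - exact: strand_ofB.
  - exact: strand_ofZ.
  - exact: of_strandB.
  - exact: of_strandZ.
  - by move=> c x y; rewrite scalerBr.
  - by move=> c x y; rewrite scalerBr.
  - exact: strand_boundary0.
  - exact: (@strand_boundaryB _ _ (strand_resolution_of F)).
  - exact: (@strand_boundaryZ _ _ (strand_resolution_of F)).
  - by move=> z; apply: strand_of_cycle.
  - by move=> z; apply: of_strand_cycle.
  - by move=> z; apply: strand_of_boundary.
  - by move=> z; apply: of_strand_boundary.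
  - by move=> z /tor_cycle_chain[_ /strand_ofK->]; rewrite subrr.
  - move=> z /strand_cycle_supported sz; rewrite of_strandK; last by move=> j /sz[].
    by rewrite subrr; apply: strand_boundary0.
apply: (@quotient_dim_transfer k _ _ (fun c v => c *: v) (fun c v => c%:MP *: v)
  _ _ _ _ (of_strand (@fr_deg _ _ F i) m) (strand_of (@fr_deg _ _ F i) m)) => //.
- exact: of_strandB.
- exact: of_strandZ.
- exact: strand_ofB.
- exact: strand_ofZ.
- by move=> c x y; rewrite scalerBr.
- by move=> c x y; rewrite scalerBr.
- exact: strand_boundary0.
- exact: (@strand_boundaryB _ _ (strand_resolution_of F)).
- exact: (@strand_boundaryZ _ _ (strand_resolution_of F)).
- by move=> z; apply: of_strand_cycle.
- by move=> z; apply: strand_of_cycle.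
- by move=> z; apply: of_strand_boundary.
- by move=> z; apply: strand_of_boundary.
- move=> z /strand_cycle_supported sz; rewrite of_strandK; last by move=> j /sz[].
  by rewrite subrr; apply: strand_boundary0.
- by move=> z /tor_cycle_chain[_ /strand_ofK->]; rewrite subrr.
Qed.

Lemma betti_nat_strand (G : strand_resolution k n) J i m : ideal J ->
  betti_nat J i m = epsilon (inhabits 0%N) (strand_dim G (contributes J m) i).
Proof.
move=> iJ; congr (epsilon _ _); apply: functional_extensionality => d.
apply: propositional_extensionality; have ds := @contributes_downset J m iJ.
split=> [[F] /(quotient_dim_strand _ _ _ _ iJ)|Gd]; first exact: strand_dim_unique.
exists (free_resolution_of G); apply/quotient_dim_strand => //.
exact: strand_dim_unique Gd.
Qed.

End Translation.

(** * The Koszul resolution *)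

(** Terms above the diagonal cancel those below. Vanishing on the diagonal is a separate hypothesis,
    since antisymmetry does not give it in characteristic 2. *)
Lemma sum_antisymmetric (V : zmodType) n (g : 'I_n -> 'I_n -> V) :
  (forall x, g x x = 0) -> (forall x y, x != y -> g x y = - g y x) ->
  \sum_x \sum_y g x y = 0.
Proof.
move=> g0 gN; rewrite pair_bigA /= (bigID (fun p : 'I_n * 'I_n => p.1 < p.2)%N) /=.
rewrite [X in _ + X](bigID (fun p : 'I_n * 'I_n => p.2 < p.1)%N) /=.
rewrite [X in _ + (_ + X)]big1 => [|[x y] /= ]; last first.
  by rewrite -!leqNgt -eqn_leq => /eqP/val_inj->.
rewrite addr0 [X in _ + X](reindex_inj (inv_inj (@swap_pairK 'I_n 'I_n))) /=.
rewrite [X in _ + X](eq_bigl (fun p : 'I_n * 'I_n => (p.1 < p.2)%N)); last first.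
  move=> [x y] /=.
  by case: ltngtP.
rewrite -big_split big1 //= => -[x y] /= lt_xy.
by rewrite (gN x y) ?addNr // neq_ltn lt_xy.
Qed.

Section Koszul.
Variables (k : fieldType) (n : nat).
Local Notation mnm := 'X_{1..n}.
Implicit Types (A B C : {set 'I_n}) (x y l : 'I_n).

(** For x in A, the sign of moving e_x to the front of e_A; for x outside A, the sign of sorting the
    product of e_x with e_A. *)
Definition ksign A x : k := (-1) ^+ #|[set y in A | (y < x)%N]|.

Lemma ksign_sqr A x : ksign A x * ksign A x = 1.
Proof. by rewrite -expr2 sqrr_sign. Qed.

Lemma ksignD1_ge A x y : (y <= x)%N -> ksign (A :\ x) y = ksign A y.
Proof.
move=> le_yx; congr (_ ^+ #|pred_of_set _|); apply/setP=> z; rewrite !inE.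
by case: (z =P x) => // ->; rewrite [(x < y)%N]ltnNge le_yx /= !andbF.
Qed.

Lemma ksignD1_lt A x y : x \in A -> (x < y)%N -> ksign (A :\ x) y = - ksign A y.
Proof.
move=> Ax lt_xy; rewrite {2}/ksign (cardsD1 x) inE Ax lt_xy exprS mulN1r opprK.
by congr (_ ^+ #|pred_of_set _|); apply/setP=> z; rewrite !inE andbA.
Qed.

(** Of two distinct elements, only the smaller one is counted in the sign of the other, so exactly
    one of the two signs changes upon removal. *)
Lemma ksign_swap A x y : x \in A -> y \in A -> x != y ->
  ksign A x * ksign (A :\ x) y = - (ksign A y * ksign (A :\ y) x).
Proof.
wlog lt_xy : x y / (x < y)%N => [W Ax Ay|Ax Ay _].
  rewrite neq_ltn => /orP[lt_xy|lt_yx]; first by apply: W; rewrite ?neq_ltn ?lt_xy.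
  by rewrite (W y x) ?opprK // neq_ltn lt_yx.
by rewrite ksignD1_lt // (ksignD1_ge _ (ltnW lt_xy)) mulrN mulrC.
Qed.

(** The coefficient of e_B in the Koszul differential of e_A with all variables set to 1.
    Homogenization restores the variable x, as [kdeg A] and [kdeg (A :\ x)] differ by exactly that
    exponent. *)
Definition kcoef A B : k := \sum_(x in A) ksign A x * (B == A :\ x)%:R.

(* Matrix of exterior multiplication by the basis vector e_l. *)
Definition wedge l A B : k := if (l \notin A) && (B == l |: A) then ksign A l else 0.

(** The differential is an antiderivation sending e_l to 1, so d(e_l w) + e_l d(w) = w:
    multiplication by e_l is a contracting homotopy. *)
Lemma wedge_homotopy l A B :
  \sum_(x in A) ksign A x * wedge l (A :\ x) B
    + (if l \notin A then ksign A l * kcoef (l |: A) B else 0) = (A == B)%:R.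
Proof.
case: ifPn => [lA|]; last first.
  (* When l is in A, only the term that removes l can be multiplied by e_l again. *)
  rewrite negbK => lA; rewrite addr0 (bigD1 l) //= big1 => [|x /andP[Ax neq]]; last first.
    by rewrite /wedge !inE eq_sym neq lA mulr0.
  rewrite /wedge !inE eqxx /= setD1K // addr0 eq_sym.
  by case: eqP => _; rewrite ?mulr0 // ksignD1_ge // ksign_sqr.
(* When l is not in A, removing l from [l |: A] gives back A, and the remaining terms cancel against
   the first sum by [ksign_swap]. *)
rewrite /kcoef big_setU1 //= setU1K // (_ : ksign (l |: A) l = ksign A l); last first.
  by rewrite -(ksignD1_ge (l |: A) (leqnn l)) setU1K.
rewrite mulrDr mulrA ksign_sqr mul1r eq_sym addrCA mulr_sumr -big_split /= big1 ?addr0 //.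
move=> x Ax; have neq : x != l by apply: contraNneq lA => <-.
have E : (l |: A) :\ x = l |: (A :\ x).
  by apply/setP=> z; rewrite !inE; case: (z =P l) => // ->; rewrite eq_sym neq.
rewrite /wedge !inE (negPf lA) andbF /= E; case: eqP => _; last by rewrite !mulr0 addr0.
rewrite mulr1; have := @ksign_swap (l |: A) x l.
rewrite !inE Ax eqxx orbT neq => /(_ isT isT isT); rewrite E setU1K //.
have -> : ksign (l |: A) l = ksign A l.
  by rewrite -(ksignD1_ge (l |: A) (leqnn l)) setU1K.
have -> : ksign (l |: A :\ x) l = ksign (A :\ x) l.
  by rewrite -(ksignD1_ge (l |: A :\ x) (leqnn l)) setU1K // !inE (negPf lA) andbF.
move=> /(congr1 (fun t => ksign A x * ksign (l |: A) x * t)).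
rewrite -mulrA [in LHS](mulrA (ksign (l |: A) x)) ksign_sqr mul1r => ->.
rewrite mulrN [X in - X]mulrC -[X in - X]mulrA (mulrA (ksign A x)) ksign_sqr mul1r.
by rewrite addNr.
Qed.

Lemma kcoef_kcoef A C : \sum_(x in A) ksign A x * kcoef (A :\ x) C = 0.
Proof.
transitivity (\sum_x \sum_y (if [&& x \in A, y \in A & x != y] then
   ksign A x * (ksign (A :\ x) y * (C == A :\ x :\ y)%:R) else 0)).
  rewrite big_mkcond; apply: eq_bigr => x _; case: ifP => Ax; last by rewrite big1.
  rewrite mulr_sumr big_mkcond; apply: eq_bigr => y _.
  by rewrite !inE andbC (eq_sym x).
apply: sum_antisymmetric => [x|x y neq]; first by rewrite eqxx !andbF.
rewrite neq (eq_sym y) neq !andbT andbC.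
case: ifP => [/andP[Ay Ax]|_]; last by rewrite oppr0.
by rewrite !mulrA ksign_swap // mulNr !setDDl setUC.
Qed.

Definition ksets (i : nat) : {set {set 'I_n}} := [set A : {set 'I_n} | #|A| == i].

Definition krank i : nat := #|ksets i|.

Definition kset i (j : 'I_(krank i)) : {set 'I_n} := enum_val j.

Lemma card_kset i (j : 'I_(krank i)) : #|kset j| = i.
Proof. by have := enum_valP j; rewrite inE => /eqP. Qed.

Lemma kset_inj i : injective (@kset i).
Proof. exact: enum_val_inj. Qed.

Lemma sum_kset i (P : pred {set 'I_n}) (f : {set 'I_n} -> k) :
  (forall B, P B -> #|B| = i) ->
  \sum_(j < krank i) (if P (kset j) then f (kset j) else 0) = \sum_(B | P B) f B.
Proof.
move=> Pi; transitivity (\sum_(B in ksets i) if P B then f B else 0).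
  by rewrite [RHS]big_enum_val.
rewrite -big_mkcondr; apply: eq_bigl => B; rewrite inE.
by case PB: (P B); rewrite ?andbF // Pi ?eqxx.
Qed.

Definition kdeg A : mnm := [multinom (j \in A : nat) | j < n].

Definition kdiff i : 'M[k]_(krank i.+1, krank i) := \matrix_(a, b) kcoef (kset a) (kset b).

Definition kwedge l i : 'M[k]_(krank i, krank i.+1) :=
  \matrix_(a, b) wedge l (kset a) (kset b).

Lemma kcoef_sum i A (f : {set 'I_n} -> k) : #|A| = i.+1 ->
  \sum_(j < krank i) kcoef A (kset j) * f (kset j) = \sum_(x in A) ksign A x * f (A :\ x).
Proof.
move=> cA; under eq_bigr do rewrite mulr_suml.
rewrite exchange_big /=; apply: eq_bigr => x Ax.
transitivity (\sum_(j < krank i)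
    if kset j == A :\ x then ksign A x * f (kset j) else 0).
  by apply: eq_bigr => j _; case: eqP => _; rewrite ?mulr1 // mulr0 mul0r.
rewrite (@sum_kset i (pred1 (A :\ x)) (fun B => ksign A x * f B)).
  by rewrite big_pred1_eq.
by move=> B /eqP->; apply: succn_inj; rewrite -cA (cardsD1 x A) Ax.
Qed.

Lemma wedge_sum l i A (f : {set 'I_n} -> k) : #|A| = i ->
  \sum_(j < krank i.+1) wedge l A (kset j) * f (kset j)
    = if l \notin A then ksign A l * f (l |: A) else 0.
Proof.
move=> cA; rewrite /wedge; case: ifPn => lA /=; last first.
  by rewrite big1 // => j _; rewrite mul0r.
transitivity (\sum_(j < krank i.+1)
    if kset j == l |: A then ksign A l * f (kset j) else 0).
  by apply: eq_bigr => j _; case: eqP => _; rewrite ?mul0r.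
rewrite (@sum_kset i.+1 (pred1 (l |: A)) (fun B => ksign A l * f B)).
  by rewrite big_pred1_eq.
by move=> B /eqP->; rewrite cardsU1 lA cA.
Qed.

Lemma kdiff_kdiff i : kdiff i.+1 *m kdiff i = 0.
Proof.
apply/matrixP=> a c; rewrite !mxE; under eq_bigr do rewrite !mxE.
by rewrite (@kcoef_sum i.+1 _ (fun B => kcoef B (kset c))) ?card_kset ?kcoef_kcoef.
Qed.

Lemma kwedge_homotopy l i :
  kdiff i *m kwedge l i + kwedge l i.+1 *m kdiff i.+1 = 1%:M.
Proof.
apply/matrixP=> a b; rewrite !mxE.
under eq_bigr do rewrite !mxE; under [X in _ + X]eq_bigr do rewrite !mxE.
rewrite (@kcoef_sum i _ (fun B => wedge l B (kset b))) ?card_kset //.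
rewrite (@wedge_sum l i.+1 _ (fun B => kcoef B (kset b))) ?card_kset //.
by rewrite wedge_homotopy (inj_eq (@kset_inj _)).
Qed.

Lemma kset0E (j : 'I_(krank 0)) : kset j = set0.
Proof. by apply/eqP; rewrite -cards_eq0 card_kset. Qed.

Lemma kwedge_homotopy0 l : kwedge l 0 *m kdiff 0 = 1%:M.
Proof.
apply/matrixP=> a b; rewrite !mxE; under eq_bigr do rewrite !mxE.
rewrite (@wedge_sum l 0 _ (fun B => kcoef B (kset b))) ?card_kset //.
have := wedge_homotopy l (kset a) (kset b).
by rewrite {1}kset0E big_set0 add0r (inj_eq (@kset_inj _)).
Qed.

Local Notation kdeg_of i := (fun j : 'I_(krank i) => kdeg (kset j)).

Lemma kdiff_graded i : graded (kdeg_of i.+1) (kdeg_of i) (kdiff i).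
Proof.
move=> a b; rewrite mxE /kcoef big_mkcond => /sum_neq0[x].
case: ifP => _; last by rewrite eqxx.
case: (kset b =P _) => [->|_]; last by rewrite mulr0 eqxx.
move=> _; apply/mnm_lepP => j; rewrite !mnmE !inE.
by case: (j \in _); rewrite ?andbF ?leq_b1.
Qed.

(** Multiplication by e_l raises the degree at l to 1, which still divides u when l occurs in u. The
    contracting homotopy thus depends on the strand: l is chosen after u, and u = 0 needs a separate
    argument. *)
Lemma kwedge_supported l i (u : mnm) v : u l != 0%N ->
  supported (below u) (kdeg_of i) v -> supported (below u) (kdeg_of i.+1) (v *m kwedge l i).
Proof.
move=> ul sv b; rewrite mxE => /sum_neq0[a].
rewrite mxE mulf_eq0 negb_or => /andP[/sv /mnm_lepP le].
rewrite /wedge; case: ifP => [/andP[_ /eqP->] _|]; last by rewrite eqxx.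
apply/mnm_lepP=> j; move: (le j); rewrite !mnmE !inE.
by case: (j =P l) => // -> _; rewrite lt0n.
Qed.

Lemma supported_kdeg0 i (v : 'rV[k]_(krank i.+1)) :
  supported (below 0%MM) (kdeg_of i.+1) v -> v = 0.
Proof.
move=> sv; apply/rowP=> j; rewrite [RHS]mxE; apply/eqP; apply: contraT => /sv/mnm_lepP le.
have /card_gt0P[l lj] : (0 < #|kset j|)%N by rewrite card_kset.
by have := le l; rewrite !mnmE lj.
Qed.

Lemma kaug_deg (j : 'I_(krank 0)) :
  (const_mx 1 : 'cV[k]_(krank 0)) j 0 != 0 -> kdeg (kset j) = 0%MM.
Proof. by move=> _; apply/mnmP=> l; rewrite kset0E !mnmE inE. Qed.

Lemma mul_kaug (v : 'rV[k]_(krank 0)) j : v *m const_mx 1 = (v 0 j)%:M :> 'M_1.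
Proof.
apply/matrixP=> a b; rewrite !ord1 !mxE (bigD1 j) //= mxE mulr1.
rewrite big1 ?addr0 ?mulr1n // => l neq.
by case/eqP: neq; apply: kset_inj; rewrite !kset0E.
Qed.

Lemma kaug_surj :
  exists2 v, supported (below 0%MM) (kdeg_of 0) v & v *m const_mx 1 = 1%:M :> 'M[k]_1.
Proof.
have /card_gt0P[A A0] : (0 < krank 0)%N.
  by apply/card_gt0P; exists set0; rewrite inE cards0.
exists (const_mx 1); last by rewrite (mul_kaug _ (enum_rank_in A0 A)) mxE.
by move=> j _; rewrite /below (@kaug_deg j) ?lepm_refl // mxE oner_neq0.
Qed.

Lemma mnm_neq0 (u : mnm) : u != 0%MM -> exists l, u l != 0%N.
Proof.
move=> nz; apply/existsP; apply: contraNT nz => /existsPn u0.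
by apply/eqP/mnmP=> l; rewrite mnm0E; apply/eqP; rewrite -[_ == _]negbK u0.
Qed.

Lemma koszul_exact0 u v : supported (below u) (kdeg_of 0) v ->
  (u = 0%MM -> v *m const_mx 1 = 0 :> 'M_1) <->
  (exists2 w, supported (below u) (kdeg_of 1) w & v = w *m kdiff 0).
Proof.
move=> sv; split=> [v0|[w sw -> u0]]; last first.
  by rewrite u0 in sw; rewrite (supported_kdeg0 sw) !mul0mx.
have [u0|/mnm_neq0[l ul]] := eqVneq u 0%MM.
  exists 0; first exact: supported0.
  rewrite mul0mx; apply/rowP=> j; rewrite [RHS]mxE; apply: scalar_mx1_inj.
  by rewrite /= -mul_kaug v0 // raddf0.
exists (v *m kwedge l 0); first exact: kwedge_supported.
by rewrite -mulmxA kwedge_homotopy0 mulmx1.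
Qed.

Lemma koszul_exact i u v : supported (below u) (kdeg_of i.+1) v ->
  v *m kdiff i = 0 <->
  (exists2 w, supported (below u) (kdeg_of i.+2) w & v = w *m kdiff i.+1).
Proof.
move=> sv; split=> [v0|[w _ ->]]; last by rewrite -mulmxA kdiff_kdiff mulmx0.
have [u0|/mnm_neq0[l ul]] := eqVneq u 0%MM.
  exists 0; first exact: supported0.
  by rewrite u0 in sv; rewrite (supported_kdeg0 sv) mul0mx.
exists (v *m kwedge l i.+1); first exact: kwedge_supported.
by rewrite -{1}[v]mulmx1 -(kwedge_homotopy l i) mulmxDr mulmxA v0 mul0mx add0r mulmxA.
Qed.

Definition koszul : strand_resolution k n :=
  @StrandResolution k n krank (fun i => kdeg_of i) kdiff (const_mx 1)
    kdiff_graded kaug_deg kaug_surj koszul_exact0 koszul_exact.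

Lemma koszul_squarefree i (j : 'I_(sr_rank koszul i)) : squarefree (sr_deg j).
Proof. by move=> l; rewrite mnmE; case: (l \in _). Qed.

End Koszul.

(** * Restriction to a subring k[V] *)

Section SubringExponents.
Variables (n : nat) (V : {set 'I_n}).

(** Extension by zero: the sum has at most one term, because [enum_val] is injective. *)
Definition ext_mnm (w : 'X_{1..#|V|}) : 'X_{1..n} :=
  [multinom (\sum_(j | enum_val j == l) w j)%N | l < n].

Lemma sub_mnmE (u : 'X_{1..n}) j : sub_mnm V u j = u (enum_val j).
Proof. exact: mnmE. Qed.

Lemma ext_mnm_enum_val w j : ext_mnm w (enum_val j) = w j.
Proof.
rewrite mnmE (bigD1 j) //= big1 ?addn0 // => i /andP[/eqP/enum_val_inj->].
by rewrite eqxx.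
Qed.

Lemma ext_mnm_notin w l : l \notin V -> ext_mnm w l = 0%N.
Proof.
by move=> lV; rewrite mnmE big1 // => j /eqP e; rewrite -e enum_valP in lV.
Qed.

Lemma enum_val_onto (T : finType) (A : {set T}) x :
  x \in A -> exists j : 'I_#|A|, x = enum_val j.
Proof. by move=> Ax; exists (enum_rank_in Ax x); rewrite enum_rankK_in. Qed.

Lemma supp_subP (u : 'X_{1..n}) :
  reflect (forall l, l \notin V -> u l = 0%N) (supp u \subset V).
Proof.
apply: (iffP subsetP) => [uV l lV|u0 l]; last by rewrite inE; apply: contraNT => /u0->.
by apply/eqP; apply: contraNT lV => ul; apply: uV; rewrite inE.
Qed.

(** Consequently the strand of degree [w] over k[V] is the strand of [F] in degree [ext_mnm w], from
    which exactness of the restriction is inherited. *)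
Lemma le_ext_mnm (u : 'X_{1..n}) w :
  (u <= ext_mnm w)%MM <-> supp u \subset V /\ (sub_mnm V u <= w)%MM.
Proof.
split=> [/mnm_lepP le|[/supp_subP uV /mnm_lepP le]]; first split.
- by apply/supp_subP=> l lV; apply/eqP; rewrite -leqn0 -(ext_mnm_notin w lV).
- by apply/mnm_lepP=> j; rewrite sub_mnmE -ext_mnm_enum_val.
apply/mnm_lepP=> l; have [/enum_val_onto[j ->]|/uV->//] := boolP (l \in V).
by rewrite ext_mnm_enum_val -sub_mnmE.
Qed.

Lemma ext_mnm_eq0 w : ext_mnm w = 0%MM <-> w = 0%MM.
Proof.
split=> [e|->]; apply/mnmP=> l; first by rewrite -ext_mnm_enum_val e !mnm0E.
by rewrite mnmE big1 ?mnm0E // => j _; rewrite mnm0E.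
Qed.

Lemma sub_embedX (k : fieldType) (u : 'X_{1..n}) : supp u \subset V ->
  sub_embed (V := V) 'X_[sub_mnm V u] = 'X_[u] :> {mpoly k[n]}.
Proof.
move=> /supp_subP uV; rewrite /sub_embed comp_mpolyX [RHS]mpolyXE_id.
rewrite (bigID (mem V)) /= [X in _ * X]big1 => [|l /uV->]; last by rewrite expr0.
rewrite mulr1 [RHS]big_enum_val; apply: eq_bigr => j _.
by rewrite tnth_mktuple sub_mnmE.
Qed.

End SubringExponents.

Section Restriction.
Variables (k : fieldType) (n : nat) (V : {set 'I_n}) (F : strand_resolution k n).

(* Keeping the basis elements whose degree involves only the variables in V
   gives a resolution over k[V], since its strands are strands of F. *)
Definition subbasis i : {set 'I_(sr_rank F i)} := [set j | supp (sr_deg j) \subset V].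

Local Notation rank i := #|subbasis i|.

Definition res_deg i (b : 'I_(rank i)) : 'X_{1..#|V|} := sub_mnm V (sr_deg (enum_val b)).

(** Right multiplication selects the coordinates in the subbasis; the transpose extends by zero. *)
Definition res_mx i : 'M[k]_(sr_rank F i, rank i) := \matrix_(a, b) (a == enum_val b)%:R.

Definition res_diff i : 'M[k]_(rank i.+1, rank i) :=
  (res_mx i.+1)^T *m sr_diff F i *m res_mx i.

Definition res_aug : 'cV[k]_(rank 0) := (res_mx 0)^T *m sr_aug F.

Lemma res_mxE i (v : 'rV[k]_(sr_rank F i)) b : (v *m res_mx i) 0 b = v 0 (enum_val b).
Proof.
rewrite mxE (bigD1 (enum_val b)) //= mxE eqxx mulr1 big1 ?addr0 // => a neq.
by rewrite mxE (negPf neq) mulr0.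
Qed.

Lemma tr_res_mxE i (w : 'rV[k]_(rank i)) b : (w *m (res_mx i)^T) 0 (enum_val b) = w 0 b.
Proof.
rewrite mxE (bigD1 b) //= !mxE eqxx mulr1 big1 ?addr0 // => a neq.
by rewrite !mxE (inj_eq enum_val_inj) eq_sym (negPf neq) mulr0.
Qed.

Lemma tr_res_mx_notin i (w : 'rV[k]_(rank i)) a :
  a \notin subbasis i -> (w *m (res_mx i)^T) 0 a = 0.
Proof.
move=> aV; rewrite mxE big1 // => b _; rewrite !mxE.
case: eqP => [e|_]; last by rewrite mulr0.
by rewrite e enum_valP in aV.
Qed.

Lemma tr_res_mxK i (w : 'rV[k]_(rank i)) : w *m (res_mx i)^T *m res_mx i = w.
Proof. by apply/rowP=> b; rewrite res_mxE tr_res_mxE. Qed.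

Lemma res_mxK i (v : 'rV[k]_(sr_rank F i)) :
  supported (fun u => supp u \subset V) (@sr_deg _ _ F i) v ->
  v *m res_mx i *m (res_mx i)^T = v.
Proof.
move=> sv; apply/rowP=> a; have [/enum_val_onto[b ->]|aV] := boolP (a \in subbasis i).
  by rewrite tr_res_mxE res_mxE.
rewrite tr_res_mx_notin //; apply/esym/eqP; apply: contraNT aV => /sv.
by rewrite inE.
Qed.

Lemma supported_tr_res i (w : 'rV[k]_(rank i)) :
  supported (fun u => supp u \subset V) (@sr_deg _ _ F i) (w *m (res_mx i)^T).
Proof.
move=> a; have [|aV] := boolP (a \in subbasis i); first by rewrite inE.
by rewrite tr_res_mx_notin ?eqxx.
Qed.

Lemma supp_downset : downset (fun u : 'X_{1..n} => supp u \subset V).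
Proof.
move=> u w /mnm_lepP le /supp_subP uV; apply/supp_subP=> l lV.
by apply/eqP; rewrite -leqn0 -(uV l lV).
Qed.

Lemma mul_res_diff i (v : 'rV[k]_(sr_rank F i.+1)) :
  supported (fun u => supp u \subset V) (@sr_deg _ _ F i.+1) v ->
  v *m res_mx i.+1 *m res_diff i = v *m sr_diff F i *m res_mx i.
Proof. by move=> sv; rewrite /res_diff !mulmxA res_mxK. Qed.

(** The subbasis spans a subcomplex, because differentials only lower degrees and the degrees
    supported in [V] form a downset. *)
Lemma mul_tr_res_diff i (w : 'rV[k]_(rank i.+1)) :
  w *m res_diff i *m (res_mx i)^T = w *m (res_mx i.+1)^T *m sr_diff F i.
Proof.
rewrite /res_diff !mulmxA res_mxK //.
exact: supported_mul supp_downset (@sr_diff_graded _ _ F i) (@supported_tr_res i.+1 w).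
Qed.

Definition restricts (s : 'X_{1..n} -> Prop) (t : 'X_{1..#|V|} -> Prop) : Prop :=
  forall u, s u <-> supp u \subset V /\ t (sub_mnm V u).

Lemma restricts_below w : restricts (below (ext_mnm w)) (below w).
Proof. by move=> u; apply: le_ext_mnm. Qed.

Lemma supported_restricts s t i (v : 'rV[k]_(sr_rank F i)) :
  restricts s t -> supported s (@sr_deg _ _ F i) v ->
  supported (fun u => supp u \subset V) (@sr_deg _ _ F i) v.
Proof. by move=> st sv j /sv/st[]. Qed.

Lemma supported_res s t i (v : 'rV[k]_(sr_rank F i)) :
  restricts s t -> supported s (@sr_deg _ _ F i) v ->
  supported t (@res_deg i) (v *m res_mx i).
Proof. by move=> st sv b; rewrite res_mxE => /sv/st[]. Qed.

Lemma supported_tr s t i (w : 'rV[k]_(rank i)) :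
  restricts s t -> supported t (@res_deg i) w ->
  supported s (@sr_deg _ _ F i) (w *m (res_mx i)^T).
Proof.
move=> st sw a; have [aV|aV] := boolP (a \in subbasis i); last by rewrite tr_res_mx_notin ?eqxx.
have [b e] := enum_val_onto aV; rewrite e tr_res_mxE => /sw tb.
by apply/st; split=> //; have := enum_valP b; rewrite inE.
Qed.

Lemma res_diff_graded i : graded (@res_deg i.+1) (@res_deg i) (res_diff i).
Proof.
apply/graded_row => a; rewrite rowE /res_diff !mulmxA.
apply: (supported_res (@restricts_below (res_deg a))).
apply: supported_mul (@below_downset _ _) (@sr_diff_graded _ _ F i) _.
apply: (supported_tr (@restricts_below (res_deg a))).
move=> b; rewrite mxE eqxx /=.
by case: (b =P a) => [-> _|_]; [apply: lepm_refl | rewrite eqxx].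
Qed.

Lemma res_aug_deg b : res_aug b 0 != 0 -> res_deg b = 0%MM.
Proof.
rewrite /res_aug mxE => /sum_neq0[a]; rewrite !mxE.
case: (a =P _) => [->|_]; last by rewrite mul0r eqxx.
rewrite mul1r => /sr_aug_deg e; apply/mnmP=> j.
by rewrite /res_deg e sub_mnmE !mnm0E.
Qed.

Lemma restricts0 : restricts (below 0%MM) (below 0%MM).
Proof. by have := @restricts_below 0%MM; rewrite (ext_mnm_eq0 _).2. Qed.

Lemma res_aug_surj :
  exists2 v, supported (below 0%MM) (@res_deg 0) v & v *m res_aug = 1%:M.
Proof.
have [v sv v1] := sr_aug_surj F; exists (v *m res_mx 0).
  exact: supported_res restricts0 sv.
by rewrite mulmxA res_mxK //; apply: supported_restricts restricts0 sv.
Qed.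

Lemma res_image s t i (w : 'rV[k]_(rank i)) : restricts s t ->
  (exists2 x, supported s (@sr_deg _ _ F i.+1) x & w *m (res_mx i)^T = x *m sr_diff F i) <->
  (exists2 y, supported t (@res_deg i.+1) y & w = y *m res_diff i).
Proof.
move=> st; split=> [[x sx e]|[y sy ->]].
  exists (x *m res_mx i.+1); first exact: supported_res sx.
  by rewrite mul_res_diff -?e ?tr_res_mxK //; apply: supported_restricts sx.
exists (y *m (res_mx i.+1)^T); first exact: supported_tr sy.
exact: mul_tr_res_diff.
Qed.

Lemma mul_res_diff_eq0 i (w : 'rV[k]_(rank i.+1)) :
  w *m res_diff i = 0 <-> w *m (res_mx i.+1)^T *m sr_diff F i = 0.
Proof.
split=> [w0|w0]; first by rewrite -mul_tr_res_diff w0 mul0mx.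
by rewrite /res_diff !mulmxA w0 mul0mx.
Qed.

Lemma res_exact0 u (w : 'rV[k]_(rank 0)) : supported (below u) (@res_deg 0) w ->
  (u = 0%MM -> w *m res_aug = 0) <->
  (exists2 y, supported (below u) (@res_deg 1) y & w = y *m res_diff 0).
Proof.
move=> sw; have st := @restricts_below u; rewrite -(res_image _ st).
rewrite -(sr_exact0 (supported_tr st sw)) mulmxA.
by split=> H u0; apply: H; apply/ext_mnm_eq0.
Qed.

Lemma res_exact i u (w : 'rV[k]_(rank i.+1)) : supported (below u) (@res_deg i.+1) w ->
  w *m res_diff i = 0 <->
  (exists2 y, supported (below u) (@res_deg i.+2) y & w = y *m res_diff i.+1).
Proof.
move=> sw; have st := @restricts_below u; rewrite -(res_image _ st).
by rewrite -(sr_exact (supported_tr st sw)) mul_res_diff_eq0.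
Qed.

Definition restriction : strand_resolution k #|V| :=
  @StrandResolution k #|V| (fun i => rank i) res_deg res_diff res_aug
    res_diff_graded res_aug_deg res_aug_surj res_exact0 res_exact.

Lemma res_cycle s t i v : restricts s t ->
  @strand_cycle _ _ F s i v -> @strand_cycle _ _ restriction t i (v *m res_mx i).
Proof.
move=> st; case: i v => [|i] v /=; first exact: supported_res.
move=> [sv v0]; split; first exact: supported_res sv.
by rewrite mul_res_diff ?v0 ?mul0mx //; apply: supported_restricts sv.
Qed.

Lemma tr_res_cycle s t i w : restricts s t ->
  @strand_cycle _ _ restriction t i w -> @strand_cycle _ _ F s i (w *m (res_mx i)^T).
Proof.
move=> st; case: i w => [|i] w /=; first exact: supported_tr.
by move=> [sw /mul_res_diff_eq0 w0]; split=> //; apply: supported_tr sw.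
Qed.

Lemma res_boundary s t i v : restricts s t ->
  @strand_boundary _ _ F s i v -> @strand_boundary _ _ restriction t i (v *m res_mx i).
Proof.
move=> st [x sx ->]; exists (x *m res_mx i.+1); first exact: supported_res sx.
by rewrite mul_res_diff //; apply: supported_restricts sx.
Qed.

Lemma tr_res_boundary s t i w : restricts s t ->
  @strand_boundary _ _ restriction t i w -> @strand_boundary _ _ F s i (w *m (res_mx i)^T).
Proof. by move=> st /(res_image _ st). Qed.

Lemma strand_dim_restriction s t i d : restricts s t ->
  strand_dim F s i d <-> strand_dim restriction t i d.
Proof.
move=> st.
have FK v : @strand_cycle _ _ F s i v -> v *m res_mx i *m (res_mx i)^T = v.
  by move=> /strand_cycle_supported sv; apply/res_mxK/(supported_restricts st).
split.
  apply: (@strand_dim_transfer k n F s i d _ _ _ (res_mx i) (res_mx i)^T).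
  - exact: (@strand_boundary0 _ _ restriction).
  - exact: (@strand_boundaryB _ _ restriction).
  - exact: (@strand_boundaryZ _ _ restriction).
  - by move=> v; apply: res_cycle.
  - by move=> v; apply: tr_res_cycle.
  - by move=> v; apply: res_boundary.
  - by move=> v; apply: tr_res_boundary.
  - by move=> v /FK->; rewrite subrr; apply: strand_boundary0.
  - move=> v _; rewrite tr_res_mxK subrr; exact: (@strand_boundary0 _ _ restriction).
apply: (@strand_dim_transfer k #|V| restriction t i d _ _ _ (res_mx i)^T (res_mx i)).
- exact: strand_boundary0.
- exact: strand_boundaryB.
- exact: strand_boundaryZ.
- by move=> v; apply: tr_res_cycle.
- by move=> v; apply: res_cycle.
- by move=> v; apply: tr_res_boundary.
- by move=> v; apply: res_boundary.
- move=> v _; rewrite tr_res_mxK subrr; exact: (@strand_boundary0 _ _ restriction).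
- by move=> v /FK->; rewrite subrr; apply: strand_boundary0.
Qed.

End Restriction.

(** Agreement is asked only at degrees of basis elements; for the Koszul resolution these are
    squarefree, which is how squarefreeness enters the comparison of the ideals. *)
Lemma strand_dim_ext (k : fieldType) n (F : strand_resolution k n) s t i :
  (forall i (j : 'I_(sr_rank F i)), s (sr_deg j) <-> t (sr_deg j)) ->
  strand_dim F s i = strand_dim F t i.
Proof.
move=> st.
have E j : supported s (@sr_deg _ _ F j) = supported t (@sr_deg _ _ F j).
  apply: functional_extensionality => v; apply: propositional_extensionality.
  by split=> H a /H /st.
have EC : @strand_cycle _ _ F s i = @strand_cycle _ _ F t i.
  by case: (i) => [|j] /=; rewrite E.
have EB : @strand_boundary _ _ F s i = @strand_boundary _ _ F t i.
  by rewrite /strand_boundary E.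
by rewrite /strand_dim EC EB.
Qed.

(** * Ideals and squarefree degrees *)

Section Ideals.
Variables (k : fieldType) (n : nat).
Local Notation R := {mpoly k[n]}.

Lemma ideal_gen_ideal (A : R -> Prop) : ideal (ideal_gen A).
Proof.
split=> [|p q [r [a [g [Ag ->]]]] [r' [a' [g' [Ag' ->]]]]|p q [r [a [g [Ag ->]]]]].
- by exists 0%N, (fun _ => 0), (fun _ => 0); split=> [[]//|]; rewrite big_ord0.
- exists (r + r')%N, (fun j => match split j with inl i => a i | inr i => a' i end),
    (fun j => match split j with inl i => g i | inr i => g' i end); split.
    by move=> j; case: (split j).
  rewrite big_split_ord; congr (_ + _); apply: eq_bigr => i _.
    by rewrite -[lshift _ _]/(unsplit (inl i)) unsplitK.
  by rewrite -[rshift _ _]/(unsplit (inr i)) unsplitK.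
- exists r, (fun j => p * a j), g; split=> //.
  by rewrite mulr_sumr; apply: eq_bigr => j _; rewrite mulrA.
Qed.

Lemma monomial_ideal_ideal (I : R -> Prop) : monomial_ideal I -> ideal I.
Proof.
move=> [A IA]; have [g0 gD gM] := ideal_gen_ideal (fun g => exists2 a, A a & g = 'X_[a]).
split=> [|p q /IA Ip /IA Iq|p q /IA Iq]; apply/IA; [exact: g0 | exact: gD | exact: gM].
Qed.

Lemma principalX (u w : 'X_{1..n}) : (w <= u)%MM -> principal 'X_[w] ('X_[u] : R).
Proof.
move=> le; exists 1%N, (fun _ => 'X_[u - w]), (fun _ => 'X_[w]); split=> //.
by rewrite big_ord1 -mpolyXD submK.
Qed.

Lemma ideal_gen_sub (A J : R -> Prop) : ideal J -> (forall g, A g -> J g) ->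
  forall p, ideal_gen A p -> J p.
Proof.
move=> iJ AJ p [r [a [g [Ag ->]]]]; elim/big_ind: _ => [|x y|j _].
- exact: (ideal0 iJ).
- exact: (idealD iJ).
- by apply: (idealM iJ); apply: AJ.
Qed.

Lemma cap_ideal (I J : R -> Prop) : ideal I -> ideal J -> ideal (cap I J).
Proof.
move=> [I0 ID IM] [J0 JD JM]; split=> [|p q [Ip Jp] [Iq Jq]|p q [Iq Jq]]; split;
  [exact: I0 | exact: J0 | exact: ID | exact: JD | exact: IM | exact: JM].
Qed.

Lemma colon_ideal (I : R -> Prop) f : ideal I -> ideal (colon I f).
Proof.
move=> [I0 ID IM]; rewrite /colon.
split=> [|p q Ip Iq|p q Iq]; first by rewrite mul0r.
  by rewrite mulrDl; apply: ID.
by rewrite -mulrA; apply: IM.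
Qed.

Lemma sub_contract_ideal (V : {set 'I_n}) (I : R -> Prop) :
  ideal I -> ideal (sub_contract (V := V) I).
Proof.
move=> [I0 ID IM]; rewrite /sub_contract /sub_embed.
split=> [|p q Ip Iq|p q Iq]; first by rewrite comp_mpoly0.
  by rewrite comp_mpolyD; apply: ID.
by rewrite rmorphM; apply: IM.
Qed.

Lemma sqfreeX (I : R -> Prop) (u : 'X_{1..n}) : ideal I -> squarefree u ->
  sqfree I 'X_[u] <-> I 'X_[u].
Proof.
move=> iI su; split.
  by apply: ideal_gen_sub => // g [a [_ Ia] ->].
move=> Iu; exists 1%N, (fun _ => 1), (fun _ => 'X_[u]); split; first by exists u.
by rewrite big_ord1 mul1r.
Qed.

End Ideals.

(** * Divisibility between a monomial and its radical *)

Section SquareRoot.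
Variables (n : nat) (m : 'X_{1..n}).

Lemma mnm_sqrt_le : (mnm_sqrt m <= m)%MM.
Proof. by apply/mnm_lepP=> l; rewrite mnmE; case: (m l). Qed.

Lemma squarefree_le_sqrt (u : 'X_{1..n}) : squarefree u ->
  (u <= m)%MM = (u <= mnm_sqrt m)%MM.
Proof.
move=> su; apply/mnm_lepP/mnm_lepP => H l; move: (H l) (su l); rewrite mnmE;
  by case: (m l) => // p /leq_trans le _; apply: le.
Qed.

(** Multiplying x^(sqrt m - u) by m / sqrt m gives x^(m-u), which turns membership in the colon
    ideal at sqrt m into membership in [I] at m. *)
Lemma sqrt_cosqrt (u : 'X_{1..n}) : (u <= mnm_sqrt m)%MM ->
  (mnm_sqrt m - u + mnm_cosqrt m)%MM = (m - u)%MM.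
Proof. by move=> le; rewrite addmC subm_addm // mnm_sqrt_le. Qed.

Lemma cosqrt_le (u : 'X_{1..n}) : (u <= mnm_sqrt m)%MM -> (mnm_cosqrt m <= m - u)%MM.
Proof. by move=> /sqrt_cosqrt <-; apply: lem_addl. Qed.

Lemma squarefree_sub_sqrt (u : 'X_{1..n}) : squarefree (mnm_sqrt m - u)%MM.
Proof. by move=> l; rewrite mnmBE mnmE (leq_trans (leq_subr _ _)) // leq_b1. Qed.

Lemma supp_le_sqrt (u : 'X_{1..n}) : (u <= mnm_sqrt m)%MM -> supp u \subset supp m.
Proof.
move=> /mnm_lepP le; apply/subsetP=> l; rewrite !inE.
by apply: contraNneq => ml; have := le l; rewrite mnmE ml leqn0.
Qed.

End SquareRoot.

Theorem theorem4p5 (k : fieldType) (n : nat) (I : {mpoly k[n]} -> Prop)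
    (hI : monomial_ideal I) (m : 'X_{1..n}) (i : int) :
  [/\ betti I i m = betti (cap I (principal 'X_[mnm_cosqrt m])) i m,
      betti (cap I (principal 'X_[mnm_cosqrt m])) i m
        = betti (colon I 'X_[mnm_cosqrt m]) i (mnm_sqrt m)
    & betti (colon I 'X_[mnm_cosqrt m]) i (mnm_sqrt m)
        = betti (Shadow m I) i (sub_mnm (supp m) (mnm_sqrt m))].
Proof.
case: i => [i|i] //=; have iI := monomial_ideal_ideal hI.
have iC : ideal (cap I (principal 'X_[mnm_cosqrt m])).
  exact/cap_ideal/ideal_gen_ideal.
have iQ : ideal (colon I 'X_[mnm_cosqrt m]) by apply: colon_ideal.
have iS : ideal (Shadow m I) by apply: ideal_gen_ideal.
have capE : strand_dim (koszul k n) (contributes I m) i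
    = strand_dim (koszul k n) (contributes (cap I (principal 'X_[mnm_cosqrt m])) m) i.
  apply: strand_dim_ext => a j; have su := koszul_squarefree j.
  split=> [[le Iu]|[le [Iu _]]]; split=> //; split=> //.
  (* Membership in the principal ideal is automatic: a squarefree u dividing m divides sqrt m, so m
     / sqrt m divides x^(m-u). *)
  by apply/principalX/cosqrt_le; rewrite -squarefree_le_sqrt.
have colonE : strand_dim (koszul k n) (contributes I m) i
    = strand_dim (koszul k n) (contributes (colon I 'X_[mnm_cosqrt m]) (mnm_sqrt m)) i.
  apply: strand_dim_ext => a j; have su := koszul_squarefree j.
  rewrite /contributes /colon -squarefree_le_sqrt //.
  by split=> -[le Iu]; split=> //; move: Iu;
    rewrite -mpolyXD sqrt_cosqrt // -squarefree_le_sqrt.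
rewrite !(betti_nat_strand (koszul k n)) // -capE -colonE; split=> //.
(* The return to the colon ideal at [mnm_sqrt m] is deliberate: [restricts] quantifies over all u,
   squarefree or not, and the description of the shadow matches the colon ideal for every u dividing
   sqrt m. *)
rewrite (betti_nat_strand (restriction (supp m) (koszul k n))) // colonE.
congr (epsilon _ _); apply: functional_extensionality => d.
apply: propositional_extensionality; apply: strand_dim_restriction => u.
have sqE : supp u \subset supp m ->
    (u <= mnm_sqrt m)%MM = (sub_mnm (supp m) u <= sub_mnm (supp m) (mnm_sqrt m))%MM.
  move=> /supp_subP uV; apply/mnm_lepP/mnm_lepP => [le j|le l]; first by rewrite !sub_mnmE.
  have [/enum_val_onto[j ->]|/uV->//] := boolP (l \in supp m).
  by have := le j; rewrite !sub_mnmE.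
have subE : (sub_mnm (supp m) (mnm_sqrt m) - sub_mnm (supp m) u)%MM
    = sub_mnm (supp m) (mnm_sqrt m - u)%MM.
  by apply/mnmP=> j; rewrite mnmBE !sub_mnmE mnmBE.
(* Passing to [sqfree] loses nothing here, since sqrt m - u is itself a squarefree exponent. *)
have sqS : Shadow m I 'X_[sub_mnm (supp m) (mnm_sqrt m - u)]
    <-> colon I 'X_[mnm_cosqrt m] 'X_[mnm_sqrt m - u].
  rewrite /Shadow sqfreeX.
  - by rewrite /sub_contract sub_embedX // supp_le_sqrt // lem_subr.
  - exact: sub_contract_ideal.
  - by move=> j; rewrite sub_mnmE; apply: squarefree_sub_sqrt.
rewrite /contributes subE; split=> [[le Ju]|[uV [le Ju]]].
  by have uV := supp_le_sqrt le; rewrite -sqE //; do !split=> //; apply/sqS.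
by rewrite sqE //; split=> //; apply/sqS.
Qed.
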